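(* Let $G$ be a totally disconnected locally compact group and let $\mathfrak{H}$ be a finitely generated subgroup of $\mathrm{Aut}(G)$ which has local tidy subgroups. Then there is a compact open subgroup $U$ of $G$ which is tidy for $\mathfrak{H}$, that is, tidy for every $\alpha\in\mathfrak{H}$.
   Context: $\mathrm{Aut}(G)$ is the group of automorphisms of the topological group $G$ (continuous with continuous inverse). A compact open subgroup $V$ of $G$ is tidy for $\alpha\in\mathrm{Aut}(G)$ if $[\alpha(V'):\alpha(V')\cap V']$, as $V'$ ranges over all compact open subgroups of $G$, is minimised at $V'=V$. It is known that $V$ is tidy for $\alpha$ if and only if (T1) $V=V_{\alpha+}V_{\alpha-}$, where $V_{\alpha\pm}=\bigcap_{n\ge 0}\alpha^{\pm n}(V)$, and (T2) $\bigcup_{n\ge 0}\alpha^n(V_{\alpha+})$ is closed. A compact open subgroup $U$ is invariably tidy for a finite set $\mathfrak{a}$ of automorphisms if for every $\gamma$ in the group $\langle\mathfrak{a}\rangle$ generated by $\mathfrak{a}$, $\gamma(U)$ is tidy for each $\alpha\in\mathfrak{a}$. A group $\mathfrak{H}$ of automorphisms has local tidy subgroups if for every finite subset $\mathfrak{a}$ of $\mathfrak{H}$ there is a compact open subgroup of $G$ which is invariably tidy for $\mathfrak{a}$. *)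

(* Defs.v *)
From HB Require Import structures.
From mathcomp Require Import all_boot.
From mathcomp Require Import boolp classical_sets functions cardinality topology.

Set Implicit Arguments.
Unset Strict Implicit.
Unset Printing Implicit Defensive.

Local Open Scope classical_set_scope.
Local Open Scope card_scope.

HB.structure Definition PreTopologicalGroup := {G of Topological G & Group G}.

HB.mixin Record PreTopologicalGroup_isTopologicalGroup G
    & PreTopologicalGroup G := {
  mulg_continuous : continuous (fun x : G * G => (x.1 * x.2)%g);
  invg_continuous : continuous (fun x : G => (x^-1)%g);
}.

#[short(type="topologicalGroupType")]
HB.structure Definition TopologicalGroup :=
  {G of PreTopologicalGroup G & PreTopologicalGroup_isTopologicalGroup G}.

Section AutomorphismGroup.
Variable G : topologicalGroupType.

Record topAut := TopAut {
  topAut_fun :> G -> G;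
  topAut_inv : G -> G;
  topAutM : {morph topAut_fun : x y / (x * y)%g};
  topAutK : cancel topAut_fun topAut_inv;
  topAutVK : cancel topAut_inv topAut_fun;
  topAut_continuous : continuous topAut_fun;
  topAutV_continuous : continuous topAut_inv;
}.

Lemma topAutP (a b : topAut) : a =1 b -> a = b.
Proof.
case: a b => [f f' fM fK f'K fc f'c] [g g' gM gK g'K gc g'c] /= /funext efg.
subst g; have e : f' = g' by apply/funext => x; rewrite -[in LHS](g'K x) fK.
by subst g'; congr TopAut; exact: Prop_irrelevance.
Qed.

Definition topAut_one : topAut :=
  @TopAut id id (fun _ _ => erefl) (fun _ => erefl) (fun _ => erefl)
    (fun _ => cvg_id) (fun _ => cvg_id).

Program Definition topAut_mul (a b : topAut) : topAut :=
  @TopAut (a \o b) (topAut_inv b \o topAut_inv a) _ _ _ _ _.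
Next Obligation. by move=> a b x y /=; rewrite !topAutM. Qed.
Next Obligation. by move=> a b; apply: can_comp; exact: topAutK. Qed.
Next Obligation. by move=> a b; apply: can_comp; exact: topAutVK. Qed.
Next Obligation.
by move=> a b x; apply: continuous_comp; exact: topAut_continuous.
Qed.
Next Obligation.
by move=> a b x; apply: continuous_comp; exact: topAutV_continuous.
Qed.

Program Definition topAut_invg (a : topAut) : topAut :=
  @TopAut (topAut_inv a) a _ (@topAutVK a) (@topAutK a)
    (@topAutV_continuous a) (@topAut_continuous a).
Next Obligation.
by move=> a x y; apply: (can_inj (@topAutK a)); rewrite topAutM !topAutVK.
Qed.

HB.instance Definition _ := gen_eqMixin topAut.
HB.instance Definition _ := gen_choiceMixin topAut.

Lemma topAut_mulA : associative topAut_mul.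
Proof. by move=> a b c; apply: topAutP. Qed.
Lemma topAut_mul1 : left_id topAut_one topAut_mul.
Proof. by move=> a; apply: topAutP. Qed.
Lemma topAut_mulr1 : right_id topAut_one topAut_mul.
Proof. by move=> a; apply: topAutP. Qed.
Lemma topAut_mulV : left_inverse topAut_one topAut_invg topAut_mul.
Proof. by move=> a; apply: topAutP => x /=; rewrite topAutK. Qed.
Lemma topAut_mulrV : right_inverse topAut_one topAut_invg topAut_mul.
Proof. by move=> a; apply: topAutP => x /=; rewrite topAutVK. Qed.

HB.instance Definition _ := isGroup.Build topAut
  topAut_mulA topAut_mul1 topAut_mulr1 topAut_mulV topAut_mulrV.

End AutomorphismGroup.

Definition subgroup (X : groupType) (H : set X) : Prop := group_closed [in H].

Lemma subgroupP (X : groupType) (H : set X) :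
  subgroup H <-> H 1%g /\ forall x y, H x -> H y -> H (x * y^-1)%g.
Proof.
split=> -[H1 HV]; split; rewrite ?inE//; first by rewrite inE in H1.
- by move=> x y Hx Hy; have := HV x y; rewrite !inE; apply.
- by move=> x y; rewrite !inE; exact: HV.
Qed.

Definition generated (X : groupType) (F : set X) : set X :=
  smallest (@subgroup X) F.

Lemma generated_subgroup (X : groupType) (F : set X) : subgroup (generated F).
Proof.
apply/subgroupP; split=> [|x y Fx Fy] K [/[dup] sK /subgroupP[K1 KV] FK] //.
by apply: KV; [exact: Fx|exact: Fy].
Qed.

Definition finitely_generated (X : groupType) (H : set X) : Prop :=
  exists2 F : set X, finite_set F & H = generated F.

Definition lcosets (X : groupType) (K L : set X) : set (set X) :=
  [set [set (x * y)%g | y in L] | x in K].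

Section Tidy.
Variable G : topologicalGroupType.
Implicit Types (a : topAut G) (U V : set G) (F H : set (topAut G)).

Definition compact_open_subgroup V : Prop :=
  [/\ subgroup V, compact V & open V].

(* The coset space whose cardinality is the index [a(V) : a(V) n V]. Indices
   are compared below as cardinalities, so no convention is needed for
   infinite ones (for compact open V the coset space is finite). *)
Definition displacement_cosets a V : set (set G) :=
  lcosets (a @` V) (a @` V `&` V).

Definition tidy a V : Prop :=
  compact_open_subgroup V /\
  forall V', compact_open_subgroup V' ->
    displacement_cosets a V #<= displacement_cosets a V'.

Definition invariably_tidy F U : Prop :=
  compact_open_subgroup U /\
  forall c, generated F c -> forall a, F a -> tidy a (c @` U).

Definition has_local_tidy_subgroups H : Prop :=
  forall F, finite_set F -> F `<=` H -> exists U, invariably_tidy F U.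

Definition tidy_for H U : Prop := forall a, H a -> tidy a U.

End Tidy.

(* Main.v *)
Require Import Defs.
From HB Require Import structures.
From mathcomp Require Import all_boot order ssralg ssrnum ssrint rat.
From mathcomp Require Import boolp classical_sets functions cardinality topology zify.

Set Implicit Arguments.
Unset Strict Implicit.
Unset Printing Implicit Defensive.

Import Order.TTheory GRing.Theory Num.Theory.

Local Open Scope classical_set_scope.
Local Open Scope group_scope.

Local Notation cos := compact_open_subgroup.

(**
Let [D_a(V)] be the index of [a V `&` V] in [a V], so that tidy subgroups minimise
[D_a]. Suppose that [V = A B] with [A <= a A], [a B <= B], and that [a^n A] meets
[V] in [A] for all [n]. Then [D_{a^n}(V) = D_a(V) ^ n]; since changing [V]
multiplies [D_{a^n}] by a bounded factor at most, [V] is tidy for [a]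
([tidy_of_factor]). The tidying procedure ([uniform_exists]) produces a subgroup
with such a factorization, so the minimal value of [D_{a^n}] is the [n]-th power of
that of [D_a], and conversely every tidy subgroup has such a factorization, with
[A] the points of [V] with relatively compact backward orbit, [V `&` par a]
([tidy_factor], [tidy_plus_closed], [tidy_par]). Finite intersections of tidy
subgroups are tidy ([tidyI]).

Let [B] be the set of all conjugates under [H] of elements of a finite set and of
their inverses, and consider the decreasing limits [C] of subgroups tidy for all of
[B]. Each [b] in [B] factors [C] into an expanded and a contracted part, which are
again such limits. If both parts are proper, they have smaller displacements under
the generators of [H] ([par_of_equal_disp]). Hence every [C] is generated by
irreducible limits [D], which every element of [B] expands or contracts
([irreducible_generate]).

The translates of [D] under [H] are commensurable, and the scaling factors of Haar
measure give a homomorphism [modulus D] from [H] to the positive rationals. At an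
element of [B] its value is an integer or the inverse of an integer; at the
generators it is bounded in terms of their minimal displacements. So only finitely
many homomorphisms can occur, and they are known before the finite set is chosen.
The finite set can therefore contain, for each of them, either an element showing
that it does not occur, or a generator of its cyclic image and elements that
normally generate its kernel ([cyclic_test_set]). Then an element of [H] expands [D]
if its modulus is at least [1] and contracts [D] if it is at most [1]
([irreducible_comparable]). Let the finite set also contain an element for each
pattern of comparisons of these homomorphisms with [1] ([sign_test_set]), and let
[U] be invariably tidy for it. For [g] in [H] choose [c] in the finite set with the
same pattern: the irreducible subgroups of the part of [U] expanded by [c] are
expanded by [g], similarly for the contracted part, and so the factorization of [U]
for [c] shows that [U] is tidy for [g].
*)

(** * Subgroups and product sets *)

Section GroupSets.
Variable X : groupType.
Implicit Types (A B C D : set X) (x y : X).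

Lemma mulgAr x y z : x * y * z = x * (y * z).
Proof. by rewrite mulgA. Qed.

(** Reduces a word in a group to normal form, so that two expressions of the same
group element become syntactically equal. *)
Definition gE := (@invgM X, @invgK X, @invg1 X, mulgAr, @mulKg X, @mulVKg X,
  @mulVg X, @mulgV X, @mul1g X, @mulg1 X).

Lemma sg1 A : subgroup A -> A 1. Proof. by case/subgroupP. Qed.

Lemma sgV A x : subgroup A -> A x -> A x^-1.
Proof. by case/subgroupP => A1 AV Ax; rewrite -[x^-1]mul1g; exact: AV. Qed.

Lemma sgM A x y : subgroup A -> A x -> A y -> A (x * y).
Proof.
by move=> /[dup] sA /subgroupP[A1 AV] Ax Ay; rewrite -[y]invgK; apply: AV => //; exact: sgV.
Qed.

Lemma sgVM A x y : subgroup A -> A x -> A y -> A (x^-1 * y).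
Proof. by move=> sA Ax Ay; apply: sgM => //; exact: sgV. Qed.

Lemma sgMl A x y : subgroup A -> A x -> A (x * y) -> A y.
Proof. by move=> sA Ax Axy; rewrite -[y](mulKg x); exact: sgVM. Qed.

Lemma sgMr A x y : subgroup A -> A y -> A (x * y) -> A x.
Proof. by move=> sA Ay Axy; rewrite -[x](mulgK y); apply: sgM => //; exact: sgV. Qed.

Lemma sgI A B : subgroup A -> subgroup B -> subgroup (A `&` B).
Proof.
move=> /subgroupP[A1 AV] /subgroupP[B1 BV]; apply/subgroupP; split=> // x y [? ?] [? ?].
by split; [exact: AV|exact: BV].
Qed.

(** The product set [A B]. Membership names one factor only; the other is then
forced. *)
Definition smul A B := [set x | exists2 a, A a & B (a^-1 * x)].

End GroupSets.

Notation "A *s B" := (smul A B) (at level 40, left associativity).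

(** * Indices of subgroups *)

Section Index.
Variable X : groupType.
Implicit Types (A B C D : set X) (x y : X).

Definition separated_mod A B (T : finType) (r : T -> X) :=
  (forall t, A (r t)) /\ (forall t u, B ((r t)^-1 * r u) -> t = u).

(** The representatives may lie outside [A], so that a cover of [A] also covers
every subset of [A]. *)
Definition covers A B (T : finType) (r : T -> X) :=
  forall x, A x -> exists t, B ((r t)^-1 * x).

(** Sending a separated family to the cosets of a cover is injective. Every
comparison of indices below comes from this map. *)
Lemma separated_le_covers A B (T U : finType) (r : T -> X) (s : U -> X) :
  subgroup B -> separated_mod A B r -> covers A B s -> (#|T| <= #|U|)%N.
Proof.
move=> sB [Ar rB] As.
have /choice[f fP] t : exists u, B ((s u)^-1 * r t) by exact/As/Ar.
apply: (@leq_card _ _ f) => t u ftu; apply: rB.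
have := sgVM sB (fP t); rewrite ftu => /(_ _ (fP u)).
by rewrite !gE.
Qed.

Definition fin A B := exists n (r : 'I_n -> X), covers A B r.

Lemma fin_covers A B (T : finType) (r : T -> X) : covers A B r -> fin A B.
Proof.
move=> Ar; exists #|T|, (fun i => r (enum_val i)) => x /Ar[t Bt].
by exists (enum_rank t); rewrite enum_rankK.
Qed.

(** A separated family of maximal size is a transversal: a point of [A] in none of
its cosets could be added to it. *)
Lemma separated_bound A B N : subgroup B ->
  (forall n (r : 'I_n -> X), separated_mod A B r -> (n <= N)%N) ->
  exists n (r : 'I_n -> X), separated_mod A B r /\ covers A B r.
Proof.
move=> sB leN.
pose P n := `[< exists r : 'I_n -> X, separated_mod A B r >].
have exP : exists n, P n.
  by exists 0; apply/asboolP; exists (fun=> 1); split=> -[].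
have PN n : P n -> (n <= N)%N by move=> /asboolP[r /leN].
case: (ex_maxnP exP PN) => n /asboolP[r [Ar rB]] nmax.
exists n, r; split=> // x Ax; apply: contrapT => /forallNP xr.
suff /nmax : P n.+1 by rewrite ltnn.
apply/asboolP; pose s (i : 'I_n.+1) := if unlift ord_max i is Some j then r j else x.
exists s; split=> [i|i j]; rewrite /s.
  by case: unliftP.
case: unliftP => [i' ->|->]; case: unliftP => [j' ->|->] //.
- by move=> /rB ->.
- by move=> /xr.
- by move=> /(sgV sB); rewrite !gE => /xr.
Qed.

Lemma fin_transversal A B : subgroup B -> fin A B ->
  exists n (r : 'I_n -> X), separated_mod A B r /\ covers A B r.
Proof.
move=> sB [N [s As]]; apply: (@separated_bound _ _ N) => // n r Ar.
by have := separated_le_covers sB Ar As; rewrite !card_ord.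
Qed.

(** The index of [A `&` B] in [A], counted as the number of left cosets of [B] that
meet [A]; it is [0] when there are infinitely many. *)
Definition ind A B : nat :=
  xget 0 [set n | exists r : 'I_n -> X, separated_mod A B r /\ covers A B r].

Lemma indP A B : subgroup B -> fin A B ->
  exists r : 'I_(ind A B) -> X, separated_mod A B r /\ covers A B r.
Proof.
move=> sB /(fin_transversal sB)[n nP].
by rewrite /ind; case: xgetP => [m _ //|/(_ n)/(_ nP)].
Qed.

Lemma ind_le_covers A B (T : finType) (r : T -> X) :
  subgroup B -> covers A B r -> (ind A B <= #|T|)%N.
Proof.
move=> sB Ar; have [s [As _]] := indP sB (fin_covers Ar).
by have := separated_le_covers sB As Ar; rewrite card_ord.
Qed.

Lemma separated_le_ind A B (T : finType) (r : T -> X) :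
  subgroup B -> fin A B -> separated_mod A B r -> (#|T| <= ind A B)%N.
Proof.
move=> sB fAB Ar; have [s [_ sA]] := indP sB fAB.
by have := separated_le_covers sB Ar sA; rewrite card_ord.
Qed.

Lemma ind_eq A B (T : finType) (r : T -> X) :
  subgroup B -> separated_mod A B r -> covers A B r -> ind A B = #|T|.
Proof.
move=> sB rs rc; apply/eqP; rewrite eqn_leq (ind_le_covers sB rc)/=.
by rewrite (separated_le_ind _ (fin_covers rc) rs).
Qed.

Lemma fin_sub A A' B : A `<=` A' -> fin A' B -> fin A B.
Proof. by move=> AA' [n [r Ar]]; exists n, r => x /AA'/Ar. Qed.

Lemma fin_supr A B B' : B `<=` B' -> fin A B -> fin A B'.
Proof. by move=> BB' [n [r Ar]]; exists n, r => x /Ar[t /BB' Bt]; exists t. Qed.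

Lemma ind_supr A B B' : subgroup B -> subgroup B' -> B `<=` B' -> fin A B ->
  (ind A B' <= ind A B)%N.
Proof.
move=> sB sB' BB' fB; have [r [_ rc]] := indP sB fB.
rewrite -[leqRHS]card_ord; apply: (ind_le_covers (r := r)) => // x /rc[t /BB' ?].
by exists t.
Qed.

Lemma fin_trans A B C : fin A B -> fin B C -> fin A C.
Proof.
move=> [n [r rA]] [m [s sB]].
apply: (@fin_covers _ _ ('I_n * 'I_m)%type (fun p => r p.1 * s p.2)) => x.
move=> /rA[i /sB[j ?]]; exists (i, j).
by rewrite /= invgM -mulgA.
Qed.

Lemma ind_trans A B C : subgroup B -> subgroup C -> fin A B -> fin B C ->
  (ind A C <= ind A B * ind B C)%N.
Proof.
move=> sB sC fAB fBC; have [r [_ rA]] := indP sB fAB; have [s [_ Bs]] := indP sC fBC.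
have -> : (ind A B * ind B C = #|{: 'I_(ind A B) * 'I_(ind B C)}|)%N.
  by rewrite card_prod !card_ord.
apply: (@ind_le_covers _ _ _ (fun p => r p.1 * s p.2)) => // x.
by move=> /rA[i /Bs[j ?]]; exists (i, j); rewrite /= invgM -mulgA.
Qed.

Lemma ind_mul A B C : subgroup A -> subgroup B -> subgroup C ->
  C `<=` B -> B `<=` A -> fin A B -> fin B C -> ind A C = (ind A B * ind B C)%N.
Proof.
move=> sA sB sC CB BA fAB fBC.
have [r [[Ar rB] rA]] := indP sB fAB; have [s [[Bs sC'] sB']] := indP sC fBC.
have -> : (ind A B * ind B C = #|{: 'I_(ind A B) * 'I_(ind B C)}|)%N.
  by rewrite card_prod !card_ord.
apply: (@ind_eq _ _ _ (fun p => r p.1 * s p.2)) => //.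
- split=> [[i j]|[i j] [i' j']] /=; first by apply: sgM => //; exact: BA.
  rewrite !gE => rs.
  have /rB ii' : B ((r i)^-1 * r i').
    apply: (sgMr sB (Bs j')); apply: (sgMl sB (sgV sB (Bs j))).
    by rewrite mulgAr; exact: CB.
  by move: rs; rewrite ii' mulKg => /sC' ->.
- by move=> x /rA[i /sB'[j ?]]; exists (i, j); rewrite /= invgM -mulgA.
Qed.

Lemma fin_interr A B : subgroup A -> subgroup B -> fin A B -> fin A (A `&` B).
Proof.
move=> sA sB /(fin_transversal sB)[n [r [[Ar _] rA]]]; exists n, r => x Ax.
by have [t Bt] := rA _ Ax; exists t; split=> //; exact: sgVM.
Qed.

Lemma ind_interr A B : subgroup A -> subgroup B -> fin A B ->
  ind A (A `&` B) = ind A B.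
Proof.
move=> sA sB fAB; have [r [[Ar rB] rA]] := indP sB fAB.
rewrite (@ind_eq _ _ _ r) ?card_ord//; first exact: sgI.
- by split=> // t u [_ /rB].
- by move=> x Ax; have [t Bt] := rA _ Ax; exists t; split=> //; exact: sgVM.
Qed.

Lemma ind_same A B B' : subgroup A -> subgroup B -> subgroup B' -> fin A B ->
  A `&` B `<=` B' -> A `&` B' `<=` B -> fin A B' /\ ind A B' = ind A B.
Proof.
move=> sA sB sB' fAB BB' B'B; have eqI : A `&` B = A `&` B'.
  by rewrite eqEsubset; split=> x [Ax Bx]; split=> //; [exact: BB'|exact: B'B].
have fAB' : fin A B'.
  apply: (@fin_supr _ (A `&` B)); last exact: fin_interr.
  by rewrite eqI; exact: subIsetr.
by split=> //; rewrite -(ind_interr sA sB)// -(ind_interr sA sB')// eqI.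
Qed.

Lemma fin_subset A B : A `<=` B -> fin A B.
Proof.
by move=> AB; apply: (@fin_covers _ _ unit (fun=> 1)) => x /AB Bx; exists tt; rewrite !gE.
Qed.

Lemma ind_subset A B : subgroup A -> subgroup B -> A `<=` B -> ind A B = 1%N.
Proof.
move=> sA sB AB; rewrite -card_unit; apply: (@ind_eq _ _ _ (fun=> 1)) => //.
  by split=> [_|[] []//]; exact: sg1.
by move=> x /AB Bx; exists tt; rewrite !gE.
Qed.

Lemma ind_gt0 A B : subgroup A -> subgroup B -> fin A B -> (0 < ind A B)%N.
Proof.
move=> sA sB fAB; rewrite -card_unit; apply: (@separated_le_ind _ _ _ (fun=> 1)) => //.
by split=> [_|[] []//]; exact: sg1.
Qed.

Lemma ind_prod A A' B : subgroup B -> A' `<=` A -> A `<=` A' *s B -> fin A' B ->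
  fin A B /\ ind A B = ind A' B.
Proof.
move=> sB A'A AB fA'; have [r [[Ar rB] rA]] := indP sB fA'.
have cov : covers A B r.
  move=> x /AB[a /rA[t Bt] Ba]; exists t.
  by have := sgM sB Bt Ba; rewrite !gE.
split; first exact: fin_covers cov.
by rewrite (@ind_eq _ _ _ r) ?card_ord//; split=> // t; exact: A'A.
Qed.

(** A point of [A] outside [A' B] would be one more coset of [B]. *)
Lemma ind_ge_prod A A' B : subgroup B -> fin A B -> A' `<=` A ->
  (ind A B <= ind A' B)%N -> A `<=` A' *s B.
Proof.
move=> sB fAB A'A le; have fA' := fin_sub A'A fAB.
have [r [[Ar rB] rA]] := indP sB fA' => x Ax.
apply: contrapT => xr.
suff : (ind A' B < ind A' B)%N by rewrite ltnn.
rewrite (leq_trans _ le)//.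
pose s (i : 'I_(ind A' B).+1) := if unlift ord_max i is Some j then r j else x.
have := @separated_le_ind A B _ s sB fAB; rewrite card_ord; apply.
split=> [i|i j]; rewrite /s.
  by case: unliftP => // j _; exact: A'A.
case: unliftP => [i' ->|->]; case: unliftP => [j' ->|->] //.
- by move=> /rB ->.
- by move=> Bx; exfalso; apply: xr; exists (r i').
- by move=> /(sgV sB); rewrite !gE => Bx; exfalso; apply: xr; exists (r j').
Qed.

Lemma ind_le1 A B : subgroup A -> subgroup B -> fin A B -> (ind A B <= 1)%N ->
  A `<=` B.
Proof.
move=> sA sB fAB le1 x Ax.
have /(_ x Ax)[] : A `<=` [set 1] *s B.
  apply: ind_ge_prod => // [_ ->|]; first exact: sg1.
  apply: (leq_trans le1); rewrite -card_unit.
  apply: (@separated_le_ind _ _ _ (fun=> 1)) => //.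
  - by apply: (fin_sub _ fAB) => _ ->; exact: sg1.
  - by split=> // -[] [].
by move=> _ -> ; rewrite !gE.
Qed.

(** Both sides are [ind A B * ind B A] times the index of [I] in [A `&` B]. Hence
[ind A B / ind B A] behaves like a ratio of Haar measures. *)
Lemma ind_cross A B I : subgroup A -> subgroup B -> subgroup I ->
  I `<=` A `&` B -> fin A B -> fin B A -> fin (A `&` B) I ->
  (ind A B * ind B I = ind B A * ind A I)%N.
Proof.
move=> sA sB sI IAB fAB fBA fI.
have sAB := sgI sA sB.
rewrite (@ind_mul B (A `&` B) I)//; last by rewrite setIC; exact: fin_interr.
rewrite (@ind_mul A (A `&` B) I)//; last by exact: fin_interr.
by rewrite -(ind_interr sA sB)// -(ind_interr sB sA)// (setIC B A) mulnCA.
Qed.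

End Index.

Lemma img_sg (X : groupType) (f : X -> X) (A : set X) :
  {morph f : x y / x * y} -> subgroup A -> subgroup (f @` A).
Proof.
move=> fM sA.
have f1 : f 1 = 1 by apply: (mulgI (f 1)); rewrite -fM !mulg1.
have fV x : f x^-1 = (f x)^-1 by apply: (mulgI (f x)); rewrite -fM !mulgV.
apply/subgroupP; split; first by exists 1; [exact: sg1|].
move=> _ _ [x Ax <-] [y Ay <-]; exists (x * y^-1); last by rewrite fM fV.
by apply: sgM => //; exact: sgV.
Qed.

Lemma ind_img (X : groupType) (f : X -> X) (A B : set X) :
  {morph f : x y / x * y} -> injective f -> subgroup B -> fin A B ->
  fin (f @` A) (f @` B) /\ ind (f @` A) (f @` B) = ind A B.
Proof.
move=> fM fI sB fAB.
have fV x : f x^-1 = (f x)^-1.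
  by apply: (mulgI (f x)); rewrite -fM !mulgV; apply: (mulgI (f 1)); rewrite -fM !mulg1.
have [r [[Ar rB] rA]] := indP sB fAB.
have cov : covers (f @` A) (f @` B) (f \o r).
  by move=> _ [x /rA[t Bt] <-]; exists t; exists ((r t)^-1 * x); rewrite // fM fV.
split; first exact: fin_covers cov.
rewrite (@ind_eq _ _ _ _ (f \o r)) ?card_ord//; first exact: img_sg.
split=> [t|t u] /=; first by exists (r t).
by rewrite -fV -fM => -[x Bx /fI xe]; apply: rB; rewrite -xe.
Qed.

Lemma card_lcosets (X : groupType) (A B : set X) :
  subgroup A -> subgroup B -> fin A B ->
  (lcosets A (A `&` B) #= `I_(ind A B))%card.
Proof.
move=> sA sB fAB; have [r [[Ar rB] rA]] := indP sB fAB.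
have sAB := sgI sA sB.
pose c x := [set (x * y) | y in A `&` B].
have cP x y : A x -> A y -> c x = c y <-> B (x^-1 * y).
  move=> Ax Ay; split=> [xy|Bxy].
    have : c x y by rewrite xy; exists 1; [exact: sg1|rewrite mulg1].
    by move=> [z [_ Bz] <-]; rewrite mulKg.
  have Axy : A (x^-1 * y) by exact: sgVM.
  rewrite eqEsubset; split=> _ [z [Az Bz] <-].
    exists ((x^-1 * y)^-1 * z); last by rewrite !gE.
    by split; apply: sgVM.
  exists ((x^-1 * y) * z); last by rewrite !gE.
  by split; apply: sgM.
have -> : lcosets A (A `&` B) = [set c (r t) | t in [set: 'I_(ind A B)]].
  rewrite eqEsubset; split=> _ [x Ax <-].
    by have [t Bt] := rA x Ax; exists t => //; apply/cP.
  by exists (r x).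
have inj : set_inj [set: 'I_(ind A B)] (fun t => c (r t)).
  by move=> t u _ _ /cP-/(_ (Ar t) (Ar u)) /rB.
apply: (card_eq_trans (inj_card_eq inj)).
have -> : `I_(ind A B) = [set nat_of_ord t | t in [set: 'I_(ind A B)]].
  rewrite eqEsubset; split=> [i /= lti|_ [t _ <-]]; last exact: ltn_ord.
  by exists (Ordinal lti).
rewrite card_eq_sym; apply: inj_card_eq => t u _ _; exact: val_inj.
Qed.

(** * Images of sets under automorphisms *)

Section Automorphisms.
Variable G : topologicalGroupType.
Implicit Types (a b c : topAut G) (A B C : set G) (x y : G).

Lemma autM a x y : a (x * y) = a x * a y. Proof. exact: topAutM. Qed.

Lemma aut1 a : a 1 = 1.
Proof. by apply: (mulgI (a 1)); rewrite -autM !mulg1. Qed.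

Lemma autV a x : a x^-1 = (a x)^-1.
Proof. by apply: (mulgI (a x)); rewrite -autM !mulgV aut1. Qed.

Lemma autK a x : a^-1 (a x) = x. Proof. exact: topAutK. Qed.
Lemma autVK a x : a (a^-1 x) = x. Proof. exact: topAutVK. Qed.
Lemma autXS a n x : (a ^+ n.+1) x = a ((a ^+ n) x). Proof. by rewrite expgS. Qed.
Lemma autXSr a n x : (a ^+ n.+1) x = (a ^+ n) (a x). Proof. by rewrite expgSr. Qed.
Lemma autXD a m n x : (a ^+ (m + n)) x = (a ^+ m) ((a ^+ n) x).
Proof. by rewrite expgnDr. Qed.

Lemma autXV a n x : (a ^+ n) ((a^-1 ^+ n) x) = x.
Proof. by rewrite expVgn autVK. Qed.
Lemma autVX a n x : (a^-1 ^+ n) ((a ^+ n) x) = x.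
Proof. by rewrite expVgn autK. Qed.

Lemma autXBV a m n x : (m <= n)%N -> (a ^+ m) ((a^-1 ^+ n) x) = (a^-1 ^+ (n - m)) x.
Proof. by move=> mn; rewrite -{1}(subnKC mn) autXD autXV. Qed.
Lemma aut_inj a : injective a. Proof. exact: can_inj (autK a). Qed.

Lemma aut_continuous a : continuous a. Proof. exact: topAut_continuous. Qed.

Lemma img_aut a A : a @` A = [set x | A (a^-1 x)].
Proof.
rewrite eqEsubset; split=> [_ [x Ax <-]|x Ax].
  by change (A (a^-1 (a x))); rewrite autK.
by exists (a^-1 x); rewrite ?autVK.
Qed.

Lemma img_autE a A x : (a @` A) x = A (a^-1 x).
Proof. by rewrite img_aut. Qed.

Lemma img_autM a b A : (a * b) @` A = a @` (b @` A).
Proof. by rewrite image_comp. Qed.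

Lemma img_aut1 A : (1 : topAut G) @` A = A.
Proof. exact: image_id. Qed.

Lemma img_autK a A : (a^-1)%g @` (a @` A) = A.
Proof. by rewrite -img_autM mulVg img_aut1. Qed.

Lemma img_autVK a A : a @` ((a^-1)%g @` A) = A.
Proof. by rewrite -img_autM mulgV img_aut1. Qed.

Lemma img_autS a A B : A `<=` B -> a @` A `<=` a @` B.
Proof. exact: image_subset. Qed.

Lemma aut_sg a A : subgroup A -> subgroup (a @` A).
Proof. by apply: img_sg; exact: autM. Qed.

Lemma fin_aut a A B : subgroup B -> fin A B -> fin (a @` A) (a @` B).
Proof. by move=> sB /(ind_img (autM a) (@aut_inj a) sB)[]. Qed.

Lemma ind_aut a A B : subgroup B -> fin A B -> ind (a @` A) (a @` B) = ind A B.
Proof. by move=> sB /(ind_img (autM a) (@aut_inj a) sB)[]. Qed.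

End Automorphisms.

(** * Compact open subgroups *)

Section Compactness.
Variable G : topologicalGroupType.
Implicit Types (a b c : topAut G) (A B C K U V W : set G) (x y g : G).

Lemma mull_continuous g : continuous (fun x : G => g * x).
Proof.
move=> x; apply: (@continuous_comp _ _ _ (fun y => (g, y)) (fun p => p.1 * p.2)).
  by apply: cvg_pair => /=; [exact: cvg_cst|exact: cvg_id].
exact: mulg_continuous.
Qed.

Lemma mulr_continuous g : continuous (fun x : G => x * g).
Proof.
move=> x; apply: (@continuous_comp _ _ _ (fun y => (y, g)) (fun p => p.1 * p.2)).
  by apply: cvg_pair => /=; [exact: cvg_id|exact: cvg_cst].
exact: mulg_continuous.
Qed.

Lemma open_lcoset g V : open V -> open [set x | V (g^-1 * x)].
Proof. by apply: open_comp => x _; exact: mull_continuous. Qed.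

Lemma closed_quot g V : closed V -> closed [set x | V (x^-1 * g)].
Proof.
apply: closed_comp => x _; apply: (@continuous_comp _ _ _ (fun x => x^-1) (fun x => x * g)).
- exact: invg_continuous.
- exact: mulr_continuous.
Qed.

Lemma open_smul A V : open V -> open (A *s V).
Proof.
move=> oV; have -> : A *s V = \bigcup_(a in A) [set x | V (a^-1 * x)].
  by rewrite eqEsubset; split=> x [a Aa Vx]; exists a.
by apply: bigcup_open => a _; exact: open_lcoset.
Qed.

Lemma open_sg_closed V : subgroup V -> open V -> closed V.
Proof.
move=> sV oV; rewrite -[V]setCK; apply: open_closedC.
have -> : ~` V = (~` V) *s V.
  rewrite eqEsubset; split=> [x nVx|x [y nVy Vyx] Vx].
    by exists x => //; rewrite mulVg; exact: sg1.
  by apply: nVy; rewrite -[y]invgK; apply: sgV => //; exact: sgMr Vyx.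
exact: open_smul.
Qed.

Lemma open_supsg A V : subgroup A -> subgroup V -> open V -> V `<=` A -> open A.
Proof.
move=> sA sV oV VA.
have -> : A = A *s V.
  rewrite eqEsubset; split=> [x Ax|x [y Ay /VA]].
    by exists x => //; rewrite mulVg; exact: sg1.
  by move=> /(sgM sA Ay); rewrite !gE.
exact: open_smul.
Qed.

Lemma open_img a V : open V -> open (a @` V).
Proof. by rewrite img_aut => oV; apply: open_comp => // x _; exact: aut_continuous. Qed.

Lemma closed_img a V : closed V -> closed (a @` V).
Proof. by rewrite img_aut => oV; apply: closed_comp => // x _; exact: aut_continuous. Qed.

Lemma compact_img a K : compact K -> compact (a @` K).
Proof.
move=> cK; apply: continuous_compact => //.
by apply: continuous_subspaceT; exact: aut_continuous.
Qed.

Lemma compact_mul A K : compact A -> compact K ->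
  compact [set x * y | x in A & y in K].
Proof.
move=> cA cK; have := compact_setX cA cK => cAK.
have -> : [set x * y | x in A & y in K] = (fun p => p.1 * p.2) @` (A `*` K).
  rewrite eqEsubset; split=> [_ [x Ax [y Ky <-]]|_ [[x y] [Ax Ky] <-]].
    by exists (x, y).
  by exists x => //; exists y.
by apply: continuous_compact => //; apply: continuous_subspaceT; exact: mulg_continuous.
Qed.

Lemma compact_inv K : compact K -> compact [set x^-1 | x in K].
Proof.
move=> cK; apply: continuous_compact => //.
by apply: continuous_subspaceT; exact: invg_continuous.
Qed.

(** The sets [K `&` E n] generate a proper filter; its cluster points lie in every
[E n] because these are closed and decreasing. *)
Lemma compact_decreasing K (E : nat -> set G) : compact K ->
  (forall n, closed (E n)) -> (forall n, E n.+1 `<=` E n) ->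
  (forall n, K `&` E n !=set0) -> exists2 x, K x & forall n, E n x.
Proof.
move=> cK cE dE E0.
have dE' m n : (m <= n)%N -> E n `<=` E m.
  elim: n => [|n IH]; first by rewrite leqn0 => /eqP ->.
  by rewrite leq_eqVlt => /predU1P[->//|]; rewrite ltnS => /IH mn x /dE/mn.
pose F := filter_from [set: nat] (fun n => K `&` E n).
have FF : ProperFilter F.
  apply: filter_from_proper => //; apply: filter_from_filter; first by exists 0.
  move=> i j _ _; exists (maxn i j) => // x [Kx Ex].
  by split; split=> //; apply: dE' Ex; rewrite ?leq_maxl ?leq_maxr.
have [|x [Kx Fx]] := cK F FF; first by exists 0 => // x [].
exists x => // n; apply: cE => B Bx; apply: Fx => //.
by exists n => // y [].
Qed.

Lemma compact_decreasing_open K (E : nat -> set G) U : compact K -> open U ->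
  (forall n, closed (E n)) -> (forall n, E n.+1 `<=` E n) ->
  (forall x, K x -> (forall n, E n x) -> U x) -> exists n, K `&` E n `<=` U.
Proof.
move=> cK oU cE dE KU; apply: contrapT => /forallNP nU.
have [|||x Kx Ex] := @compact_decreasing K (fun n => E n `&` ~` U) cK.
- by move=> n; apply: closedI => //; exact: open_closedC.
- by move=> n x [/dE].
- move=> n; apply: contrapT => K0; apply: (nU n) => x [Kx Ex]; apply: contrapT => nUx.
  by apply: K0; exists x.
- by have [_] := Ex 0; apply; apply: KU => // n; have [] := Ex n.
Qed.

(** Otherwise the complements in [K] of finite unions of cosets of [V] would generate
a proper filter, and the coset of a cluster point would be disjoint from a member
of it. *)
Lemma fin_compact_open K V : compact K -> subgroup V -> open V -> fin K V.
Proof.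
move=> cK sV oV; apply: contrapT => nfin.
pose C (s : seq G) := [set x | K x /\ forall y, y \in s -> ~ V (y^-1 * x)].
have C0 s : C s !=set0.
  apply: contrapT => Cs; apply: nfin; exists (size s), (fun i => nth 1 s i) => x Kx.
  apply: contrapT => nV; apply: Cs; exists x; split=> // y ys Vyx; apply: nV.
  have ys' : (index y s < size s)%N by rewrite index_mem.
  by exists (Ordinal ys'); rewrite /= nth_index.
pose F := filter_from [set: seq G] C.
have FF : ProperFilter F.
  apply: filter_from_proper => //; apply: filter_from_filter; first by exists [::].
  move=> s t _ _; exists (s ++ t) => // x [Kx nV].
  by split; split=> // y ys; apply: nV; rewrite mem_cat ys ?orbT.
have [|x [Kx Fx]] := cK F FF; first by exists [::] => // x [].
have [||y [[_ nV] Vy]] := Fx (C [:: x]) [set y | V (x^-1 * y)].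
- by exists [:: x].
- apply: open_nbhs_nbhs; split; first exact: open_lcoset.
  by rewrite /= mulVg; exact: sg1.
- by apply: (nV x); rewrite ?mem_head.
Qed.

Lemma cos_sg V : cos V -> subgroup V. Proof. by case. Qed.
Lemma cos_closed V : cos V -> closed V. Proof. by case=> *; exact: open_sg_closed. Qed.

Lemma cos_I U V : cos U -> cos V -> cos (U `&` V).
Proof.
move=> /[dup] /cos_closed cU [sU kU oU] /[dup] /cos_closed cV [sV kV oV].
split; [exact: sgI| |exact: openI].
by apply: (subclosed_compact _ kU) => [|x []//]; exact: closedI.
Qed.

Lemma cos_img a V : cos V -> cos (a @` V).
Proof. by case=> *; split; [exact: aut_sg|exact: compact_img|exact: open_img]. Qed.

Lemma cos_fin U V : cos U -> cos V -> fin U V.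
Proof. by case=> ? ? ? [? ? ?]; exact: fin_compact_open. Qed.

Lemma cos_open_sub V W : cos V -> subgroup W -> open W -> W `<=` V -> cos W.
Proof.
move=> [_ kV _] sW oW WV; split=> //.
by apply: (subclosed_compact _ kV) => //; exact: open_sg_closed.
Qed.

End Compactness.

(** * Displacement of a subgroup *)

Section Displacement.
Variable G : topologicalGroupType.
Implicit Types (a b c : topAut G) (A B C K U V W : set G) (x y g : G).

(** The quantity that tidy subgroups minimise. *)
Definition disp a V := ind (a @` V) V.

Lemma tidyP a V :
  tidy a V <-> cos V /\ forall V', cos V' -> (disp a V <= disp a V')%N.
Proof.
have dP W : cos W -> (displacement_cosets a W #= `I_(disp a W))%card.
  move=> cW; apply: card_lcosets; [exact/cos_sg/cos_img|exact: cos_sg|].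
  by apply: cos_fin => //; exact: cos_img.
split=> -[cV mV]; split=> // V' cV'; have := mV V' cV'.
  by rewrite (card_le_eql (dP V cV)) (card_le_eqr (dP V' cV')) card_le_II.
by rewrite (card_le_eql (dP V cV)) (card_le_eqr (dP V' cV')) card_le_II.
Qed.

Lemma fin_disp a V : cos V -> fin (a @` V) V.
Proof. by move=> cV; apply: cos_fin => //; exact: cos_img. Qed.

Lemma disp_gt0 a V : cos V -> (0 < disp a V)%N.
Proof.
move=> cV; apply: ind_gt0; [exact/cos_sg/cos_img|exact: cos_sg|exact: fin_disp].
Qed.

(** Along the powers of one automorphism, any two compact open subgroups thus have
displacements that differ by a bounded factor only. This turns exponential growth
of the displacements into a lower bound valid for all subgroups. *)
Lemma disp_change a V V' : cos V -> cos V' ->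
  (disp a V <= ind V V' * disp a V' * ind V' V)%N.
Proof.
move=> cV cV'; have [sV sV'] := (cos_sg cV, cos_sg cV').
have [cA cA'] := (cos_img a cV, cos_img a cV').
rewrite -(ind_aut a sV' (cos_fin cV cV')).
have fA := cos_fin cA cA'.
apply: (leq_trans (ind_trans (B := V') sV' sV _ _)); [exact: cos_fin|exact: cos_fin|].
rewrite leq_mul2r; apply/orP; right.
by apply: ind_trans => //; [exact: cos_sg|exact: cos_fin].
Qed.

Lemma disp_mul a b V : cos V -> (disp (a * b)%g V <= disp b V * disp a V)%N.
Proof.
move=> cV; have [cA cB] := (cos_img a cV, cos_img b cV).
rewrite /disp img_autM -[X in (_ <= X * _)%N](ind_aut a (cos_sg cV) (fin_disp b cV)).
apply: ind_trans; [exact: cos_sg|exact: cos_sg| |exact: cos_fin].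
by apply: cos_fin => //; exact: cos_img.
Qed.

Lemma disp1 V : cos V -> disp 1 V = 1%N.
Proof. by move=> cV; rewrite /disp img_aut1 ind_subset//; exact: cos_sg. Qed.

Lemma disp_exp a n V : cos V -> (disp (a ^+ n)%g V <= disp a V ^ n)%N.
Proof.
move=> cV; elim: n => [|n IH]; first by rewrite disp1.
rewrite expgSr (leq_trans (disp_mul _ _ cV))// expnS leq_mul2l.
by rewrite IH orbT.
Qed.

End Displacement.

(** Bernoulli's inequality [1 + n / b <= (1 + 1 / b) ^ n], without denominators. *)
Lemma exp_linear b n : (b ^ n * (b + n) <= b * b.+1 ^ n)%N.
Proof.
elim: n => [|n IH]; first by rewrite !expn0 addn0 mul1n muln1.
rewrite [in leqRHS]expnSr mulnA (leq_trans _ (leq_mul IH (leqnn b.+1)))//.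
rewrite expnSr -!mulnA leq_mul2l; apply/orP; right.
by rewrite addnS mulnS mulnDl mulnS mulnS; nia.
Qed.

Lemma leq_of_exp_bound a b C : (forall n, a ^ n <= C * b ^ n)%N -> (a <= b)%N.
Proof.
move=> H; rewrite leqNgt; apply/negP => ba.
have [b0|b_gt0] := posnP b.
  by have := H 1%N; rewrite b0 muln0 leqn0 expn1 => /eqP a0; rewrite a0 in ba.
have H' n : (b.+1 ^ n <= C * b ^ n)%N.
  apply: leq_trans (H n); elim: n => // n IH.
  by rewrite !expnS leq_mul.
have := leq_trans (exp_linear b (C * b)) (leq_mul (leqnn b) (H' (C * b)%N)).
rewrite mulnA (mulnC _ (b ^ _)%N) leq_pmul2l ?expn_gt0 ?b_gt0//.
by rewrite mulnC leqNgt -[X in (X < _)%N]add0n ltn_add2r b_gt0.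
Qed.

(** * Factorization into expanded and contracted parts *)

Section Plus.
Variable G : topologicalGroupType.
Implicit Types (a b c : topAut G) (A B C K U V W : set G) (x y g : G).

(** The subgroup [V_{a+}], written through backward orbits: [x] belongs to
[a ^+ n @` V] when its [n]-th backward image is in [V]. *)
Definition plus a V := [set x | forall n, V ((a^-1 ^+ n) x)].
Definition pplus a m V := [set x | forall n, (n <= m)%N -> V ((a^-1 ^+ n) x)].

Lemma plus_sub a V : plus a V `<=` V. Proof. by move=> x /(_ 0%N). Qed.
Lemma pplus_sub a m V : pplus a m V `<=` V. Proof. by move=> x /(_ 0%N (leq0n _)). Qed.
Lemma plusS a V W : V `<=` W -> plus a V `<=` plus a W.
Proof. by move=> VW x Vx n; exact: VW. Qed.

Lemma plus_stable a V x n : plus a V x -> plus a V ((a^-1 ^+ n) x).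
Proof. by move=> Vx m; rewrite -autXD; exact: Vx. Qed.

Lemma plus_stable1 a V x : plus a V x -> plus a V (a^-1 x).
Proof. exact: (@plus_stable a V x 1). Qed.

Lemma sg_plus a V : subgroup V -> subgroup (plus a V).
Proof.
move=> sV; apply/subgroupP; split=> [n|x y Vx Vy n].
  by rewrite aut1; exact: sg1.
by rewrite autM autV; apply: sgM => //; exact: sgV.
Qed.

Lemma pplus0 a V : pplus a 0 V = V.
Proof.
rewrite eqEsubset; split=> x; first exact: pplus_sub.
by move=> Vx n; rewrite leqn0 => /eqP ->.
Qed.

Lemma pplusSr a m V : pplus a m.+1 V = pplus a m V `&` (a ^+ m.+1) @` V.
Proof.
rewrite eqEsubset; split=> x.
  move=> Vx; split=> [n nm|]; first by apply: Vx; exact: leqW.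
  by rewrite img_autE -expVgn; exact: Vx.
move=> [Vx]; rewrite img_autE -expVgn => Vmx n.
by rewrite leq_eqVlt => /predU1P[->//|]; exact: Vx.
Qed.

Lemma pplus_pplus a m n V : pplus a m (pplus a n V) = pplus a (m + n) V.
Proof.
rewrite eqEsubset; split=> x Vx k.
  move=> kmn; have [km|mk] := leqP k m; first exact: (Vx k km 0%N).
  have /(_ (k - m)%N) := Vx m (leqnn m).
  by rewrite -autXD subnK ?(ltnW mk)// leq_subLR; exact.
by move=> km j jn; rewrite -autXD; apply: Vx; rewrite addnC leq_add.
Qed.

Lemma cos_pplus a m V : cos V -> cos (pplus a m V).
Proof.
move=> cV; elim: m => [|m IH]; first by rewrite pplus0.
by rewrite pplusSr; apply: cos_I => //; exact: cos_img.
Qed.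

Lemma closed_plus a V : closed V -> closed (plus a V).
Proof.
move=> cV; have -> : plus a V = \bigcap_(n in [set: nat]) (a ^+ n) @` V.
  rewrite eqEsubset; split=> x.
    by move=> Vx n _; rewrite img_autE -expVgn; exact: Vx.
  by move=> Vx n; have := Vx n I; rewrite img_autE -expVgn.
by apply: closed_bigI => n _; exact: closed_img.
Qed.

Lemma pplus_dec a m V : pplus a m.+1 V `<=` pplus a m V.
Proof. by rewrite pplusSr => x []. Qed.

Lemma plus_pplusP a V x : (forall m, pplus a m V x) -> plus a V x.
Proof. by move=> Vx n; exact: (Vx n n). Qed.

(** Replacing [V] by [V_m = pplus a m V] never increases the displacement, since
[a V_m] meets [V_m] and [V] in the same set and is contained in [a V]. If the
displacement does not drop, then [a V_m] meets all the cosets of [V] that [a V]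
meets, so that [a V = (a V_m) V]; compactness lets [m] tend to infinity. *)
Lemma factor_step a V : cos V ->
  (forall m, disp a V <= disp a (pplus a m V))%N ->
  a @` V `<=` (a @` plus a V) *s V.
Proof.
move=> cV dV; have sV := cos_sg cV; have clV := cos_closed cV.
have VE m : a @` V `<=` (a @` pplus a m V) *s V.
  have cm := cos_pplus a m cV; have sm := cos_sg cm.
  apply: ind_ge_prod => //; [exact: fin_disp|by apply: img_autS; exact: pplus_sub|].
  apply: (leq_trans (dV m)); rewrite /disp.
  have [] // := @ind_same _ (a @` pplus a m V) (pplus a m V) V.
  - exact: aut_sg.
  - exact: fin_disp.
  - by move=> x [_ /pplus_sub].
  - move=> x []; rewrite img_autE => Vx Vx0 [|n] // nm.
    by rewrite autXSr; apply: Vx; exact: ltnW.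
  - by move=> _ ->.
move=> x Vx.
pose E m := (a @` pplus a m V) `&` [set y | V (y^-1 * x)].
have [||||y Vy Ey] := @compact_decreasing _ (a @` V) E.
- by have [] := cos_img a cV.
- move=> m; apply: closedI; last exact: closed_quot.
  by apply: closed_img; apply: cos_closed; exact: cos_pplus.
- move=> m y [Vy ?]; split=> //; apply: img_autS Vy; exact: pplus_dec.
- move=> m; have [y Vy Vyx] := VE m x Vx; exists y; split=> //.
  by apply: img_autS Vy; exact: pplus_sub.
exists y; last by have [] := Ey 0%N.
rewrite img_autE; apply: plus_pplusP => m; rewrite -img_autE.
by have [] := Ey m.
Qed.

(** By the preceding lemma a point of [V] can be corrected by an element of
[V_{a+}] so that its first forward image stays in [V]. Applying this to the
[n]-th forward image and transporting the correction back, which stays in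
[V_{a+}], gains one more step; compactness concludes. *)
Lemma factor_plus_minus a V : cos V ->
  (forall m, disp a V <= disp a (pplus a m V))%N ->
  V `<=` plus a V *s plus a^-1 V.
Proof.
move=> cV dV; have sV := cos_sg cV; have clV := cos_closed cV.
have step x : V x -> exists2 y, plus a V y & V (a (y^-1 * x)).
  move=> Vx; have [|y] := factor_step cV dV (t := a x); first by exists x.
  rewrite img_autE => Vy Vyx; exists (a^-1 y) => //.
  by rewrite autM autV autVK.
have VE n x : V x -> exists2 y, plus a V y & pplus a^-1 n V (y^-1 * x).
  move=> Vx; elim: n => [|n [y Vy Vyx]].
    exists 1; first by apply: sg1; exact: sg_plus.
    by rewrite pplus0 !gE.
  have [|z Vz Vzx] := step ((a ^+ n) (y^-1 * x)).
    by have := Vyx n (leqnn n); rewrite invgK.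
  exists (y * (a^-1 ^+ n) z).
    by apply: (@sgM _ (plus a V)); [exact: sg_plus|exact: Vy|exact: plus_stable].
  have e : (y * (a^-1 ^+ n) z)^-1 * x =
      ((a^-1 ^+ n) z)^-1 * (y^-1 * x) by rewrite !gE.
  rewrite e => k; rewrite invgK leq_eqVlt => /predU1P[->|].
    by rewrite autXS autM autV autXV.
  rewrite ltnS => kn; rewrite autM autV autXBV//; apply: sgVM => //.
  by have := Vyx k kn; rewrite invgK.
move=> x Vx.
pose E m := plus a V `&` [set y | pplus a^-1 m V (y^-1 * x)].
have [||||y Vy Ey] := @compact_decreasing _ V E.
- by case: cV.
- move=> m; apply: closedI; first exact: closed_plus.
  by apply: closed_quot; apply: cos_closed; exact: cos_pplus.
- by move=> m y [Vy ?]; split=> //; exact: pplus_dec.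
- by move=> m; have [y Vy Vyx] := VE m x Vx; exists y; split=> //; exact: plus_sub Vy.
exists y; first by have [] := Ey 0%N.
by apply: plus_pplusP => m; have [] := Ey m.
Qed.

Lemma tidy_factor a V : tidy a V -> V `<=` plus a V *s plus a^-1 V.
Proof.
move=> /tidyP[cV mV]; apply: factor_plus_minus => // m.
by apply: mV; exact: cos_pplus.
Qed.

(** In [a^n V = (a^n A) (a^n B)] the second factor lies in [V], and the first one
meets [V] in [A]: the displacement of [a^n] is the index of [A] in [a^n A], which
is multiplicative in [n]. *)
Lemma uniform_of_factor a V A B : cos V -> subgroup A -> subgroup B ->
  A `<=` V -> B `<=` V -> V `<=` A *s B ->
  (forall x, A x -> A (a^-1 x)) -> (forall x, B x -> B (a x)) ->
  (forall n x, A ((a^-1 ^+ n) x) -> V x -> A x) ->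
  (forall n, disp (a ^+ n) V = disp a V ^ n)%N.
Proof.
move=> cV sA sB AV BV VAB aA aB T2; have sV := cos_sg cV.
have aBn n x : B x -> B ((a ^+ n) x).
  by move=> Bx; elim: n => // n; rewrite autXS; exact: aB.
have fV n : fin ((a ^+ n) @` A) V.
  by apply: fin_sub (fin_disp (a ^+ n) cV); exact: img_autS.
have dE n : fin ((a ^+ n) @` A) A /\ disp (a ^+ n) V = ind ((a ^+ n) @` A) A.
  have [|||f1 e1] := @ind_same _ ((a ^+ n) @` A) V A _ sV sA (fV n).
  - exact: aut_sg.
  - by move=> x []; rewrite img_autE -expVgn; exact: T2.
  - by move=> x [_ /AV].
  split=> //; rewrite e1.
  have [] // := @ind_prod _ ((a ^+ n) @` V) ((a ^+ n) @` A) V sV.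
  - exact: img_autS.
  - move=> _ [v /VAB[y Ay Byv] <-]; exists ((a ^+ n) y); first by exists y.
    by rewrite -autV -autM; apply/BV/aBn.
elim=> [|n IH]; first by rewrite disp1.
have [fA dA] := dE n; have [_ ->] := dE n.+1.
have [fA1 dA1] := dE 1%N.
have AnS m : A `<=` (a ^+ m) @` A.
  move=> x Ax; rewrite img_autE -expVgn.
  by elim: m => // m IHm; rewrite autXS; exact: aA.
rewrite (@ind_mul _ _ ((a ^+ n) @` A)) //.
- rewrite -dA IH expnSr mulnC; congr (_ * _)%N.
  by rewrite expgSr img_autM ind_aut// -dA1.
- exact: aut_sg.
- exact: aut_sg.
- by rewrite expgSr img_autM; apply: img_autS; exact: AnS 1%N.
- by rewrite expgSr img_autM; apply: fin_aut.
Qed.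

(** If another subgroup had a smaller displacement, its powers would grow more
slowly than the displacements of [V], although the two stay within a bounded
factor of each other. *)
Lemma tidy_of_uniform a V : cos V ->
  (forall n, disp (a ^+ n) V = disp a V ^ n)%N -> tidy a V.
Proof.
move=> cV uV; apply/tidyP; split=> // V' cV'.
apply: (@leq_of_exp_bound _ _ (ind V V' * ind V' V)) => n.
rewrite -uV (leq_trans (disp_change (a ^+ n) cV cV'))// mulnAC.
by rewrite leq_mul2l disp_exp ?orbT.
Qed.

Lemma tidy_of_factor a V A B : cos V -> subgroup A -> subgroup B ->
  A `<=` V -> B `<=` V -> V `<=` A *s B ->
  (forall x, A x -> A (a^-1 x)) -> (forall x, B x -> B (a x)) ->
  (forall n x, A ((a^-1 ^+ n) x) -> V x -> A x) -> tidy a V.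
Proof.
by move=> cV *; apply: tidy_of_uniform => //; exact: (@uniform_of_factor _ _ A B).
Qed.

End Plus.

(** * The tidying procedure *)

Section Tidying.
Variable G : topologicalGroupType.
Implicit Types (a b c : topAut G) (A B C K L P U V W : set G) (x y g : G).

(** The increasing union [V_{a++}] of the forward images of [V_{a+}]. *)
Definition plusplus a V := [set x | exists n, plus a V ((a^-1 ^+ n) x)].
(** The points whose orbit is in [V] at all but finitely many times, in both
directions. A tidy [V] contains them; in general they are what obstructs tidiness once [V]
factors. *)
Definition ell a V := plusplus a V `&` plusplus a^-1 V.

Lemma plusplus_le a V x n : plus a V ((a^-1 ^+ n) x) ->
  forall m, (n <= m)%N -> plus a V ((a^-1 ^+ m) x).
Proof. by move=> Vx m nm; rewrite -(subnK nm) autXD; exact: plus_stable. Qed.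

Lemma sg_plusplus a V : subgroup V -> subgroup (plusplus a V).
Proof.
move=> sV; have sp := sg_plus a sV; apply/subgroupP; split.
  by exists 0%N; exact: (sg1 sp).
move=> x y [n Vx] [m Vy]; exists (maxn n m); rewrite autM autV.
apply: (@sgM _ (plus a V)) => //; last apply: (@sgV _ (plus a V)) => //.
- exact: plusplus_le Vx _ (leq_maxl _ _).
- exact: plusplus_le Vy _ (leq_maxr _ _).
Qed.

Lemma plus_plusplus a V : plus a V `<=` plusplus a V.
Proof. by move=> x Vx; exists 0%N. Qed.

Lemma plusplus_stable a V x : plusplus a V x -> plusplus a V (a x) /\ plusplus a V (a^-1 x).
Proof.
move=> [n Vx]; split.
  by exists n.+1; rewrite autXSr autK.
by exists n; rewrite -autXSr autXS; exact: plus_stable1.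
Qed.

Lemma sg_ell a V : subgroup V -> subgroup (ell a V).
Proof. by move=> sV; apply: sgI; exact: sg_plusplus. Qed.

Lemma ell_stable a V x : ell a V x -> ell a V (a x) /\ ell a V (a^-1 x).
Proof.
move=> [/plusplus_stable[? ?] /plusplus_stable[]]; rewrite invgK => ? ?.
by split; split.
Qed.

Lemma ell_stableX a V x n : ell a V x -> ell a V ((a ^+ n) x) /\ ell a V ((a^-1 ^+ n) x).
Proof.
move=> Lx; elim: n => // n [/ell_stable[IH _] /ell_stable[_ IH']].
by rewrite !autXS.
Qed.

(** Let [L' = ell a V `&` plus a V]. Finitely many elements [r i] of [a L']
represent [a L'] modulo [L'], and after a common number [K] of steps their forward
orbits stay in [V]. Writing a point of [a^n L'] as a product of forward images of
the [r i] and of an element of [L'], all the factors moved at least [K] times are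
in [V_{a-}], so the point is in the product of [V_{a-}] and [a^K L']. *)
Lemma ell_bounded a V : cos V -> exists2 K, compact K & ell a V `<=` K.
Proof.
move=> cV; have sV := cos_sg cV; have sL := sg_ell a sV; have sp := sg_plus a sV.
pose Lp := ell a V `&` plus a V; have sLp : subgroup Lp by exact: sgI.
have Lp1 x n : Lp x -> Lp ((a^-1 ^+ n) x).
  move=> [Lx Vx]; split; last exact: plus_stable.
  by have [] := ell_stableX n Lx.
have fV : fin (a @` Lp) V.
  by apply: fin_sub (fin_disp a cV); apply: img_autS => x [_ /plus_sub].
have [|||fL _] := ind_same _ sV sLp fV.
- exact: aut_sg.
- move=> x []; rewrite img_autE => -[/ell_stable[Lx _] Vx] Vx0.
  split; first by rewrite autVK in Lx.
  by case=> [|n] //; rewrite autXSr; exact: Vx.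
- by move=> x [_ [_ /plus_sub]].
have [m [r [[rA _] rc]]] := fin_transversal sLp fL.
have /choice[k kP] i : exists k, plus a^-1 V ((a ^+ k) (r i)).
  have := rA i; rewrite img_autE => -[/ell_stable[Lx _] _].
  by move: Lx; rewrite autVK => -[_ [n]]; rewrite invgK; exists n.
pose K := (\max_i k i)%N.
have KP n i : (K <= n)%N -> plus a^-1 V ((a ^+ n) (r i)).
  move=> Kn; have := @plusplus_le a^-1 V (r i) (k i); rewrite invgK; apply=> //.
  by apply: leq_trans Kn; exact: leq_bigmax.
have main n x : Lp ((a^-1 ^+ n) x) ->
    exists2 v, plus a^-1 V v & Lp ((a^-1 ^+ K) (v^-1 * x)).
  elim: n x => [|n IH] x Lx.
    exists 1; first by apply: sg1; exact: sg_plus.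
    by rewrite !gE; exact: Lp1.
  have [nK|Kn] := ltnP n K.
    exists 1; first by apply: sg1; exact: sg_plus.
    by rewrite !gE -(subnK nK) autXD; exact: Lp1.
  have [|i ri] := rc ((a^-1 ^+ n) x); first by rewrite img_autE -autXS.
  have [|v Vv Lv] := IH (((a ^+ n) (r i))^-1 * x).
    by rewrite autM autV autVX.
  exists ((a ^+ n) (r i) * v); last by rewrite invgM mulgAr.
  by apply: (@sgM _ (plus a^-1 V)); [exact: sg_plus|exact: KP|].
exists [set x * y | x in V & y in (a ^+ K) @` V].
  by apply: compact_mul; [case: cV|apply: compact_img; case: cV].
move=> x Lx; have [[n Vx] _] := Lx.
have [|v /plus_sub Vv [_ /plus_sub Lv]] := main n x.
    by split=> //; have [] := ell_stableX n Lx.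
exists v => //; exists (v^-1 * x); last by rewrite !gE.
by rewrite img_autE -expVgn.
Qed.

Lemma fin_ell a V : cos V -> fin (ell a V) V.
Proof.
move=> cV; have [K cK /fin_sub] := ell_bounded a cV; apply.
by apply: fin_compact_open => //; case: cV.
Qed.

Lemma sg_smul A L : subgroup A -> subgroup L ->
  (forall l x, L l -> A x -> A (l^-1 * x * l)) -> subgroup (A *s L).
Proof.
move=> sA sL nA; have nA' l x : L l -> A x -> A (l * x * l^-1).
  by move=> /(sgV sL) Ll /(nA _ _ Ll); rewrite invgK.
apply/subgroupP; split.
  by exists 1; [exact: sg1|rewrite !gE; exact: sg1].
move=> x y [a Aa Lx] [b Ab Ly].
pose l := a^-1 * x; pose m := b^-1 * y.
have -> : x = a * l by rewrite /l !gE.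
have -> : y = b * m by rewrite /m !gE.
have Llm : L (l * m^-1) by apply: sgM => //; exact: sgV.
exists (a * ((l * m^-1) * b^-1 * (l * m^-1)^-1)).
  by apply: sgM => //; apply: nA' => //; exact: sgV.
by move: Llm; rewrite /l /m !gE.
Qed.

Lemma smull A L : subgroup L -> A `<=` A *s L.
Proof. by move=> sL x Ax; exists x => //; rewrite mulVg; exact: sg1. Qed.

(** The largest subset of [V] normalised by [L]. *)
Definition conj_core L V := [set x | forall l, L l -> V (l^-1 * x * l)].

(** Conjugates of [V] by elements of the same coset of [V] coincide, so only
finitely many conjugates are intersected. *)
Lemma cos_conj_core L V : subgroup L -> fin L V -> cos V -> cos (conj_core L V).
Proof.
move=> sL fL cV; have sV := cos_sg cV; have oV : open V by case: cV.
apply: (cos_open_sub cV).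
- apply/subgroupP; split=> [l Ll|x y Vx Vy l Ll]; first by rewrite !gE; exact: sg1.
  have := sgM sV (Vx l Ll) (sgV sV (Vy l Ll)).
  by rewrite !gE.
- have [n [r [[rL _] rc]]] := fin_transversal sV fL.
  have VE x : (forall i, V ((r i)^-1 * x * r i)) -> conj_core L V x.
    move=> Vr l /rc[i Vi]; have := sgM sV (sgM sV (sgV sV Vi) (Vr i)) Vi.
    by rewrite !gE.
  rewrite openE => x Vx; rewrite /interior.
  have : \forall y \near x, forall i, V ((r i)^-1 * y * r i).
    apply: filter_forall => i.
    have : open [set y | V ((r i)^-1 * y * r i)].
      have := @open_lcoset G (r i) [set y | V (y * r i)]; apply.
      by apply: open_comp => // y _; exact: mulr_continuous.
    by rewrite openE => /(_ x); apply; exact: Vx.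
  by apply: filterS => y; exact: VE.
- by move=> x /(_ 1 (sg1 sL)); rewrite !gE.
Qed.

(** The tidying procedure. Inside the largest subgroup of [V] normalised by
[L = ell a V], an intersection [W] of finitely many
translates, with minimal displacement, factors as [W_{a+} W_{a-}] and is still normalised by [L]. The group [W L] then
satisfies the hypotheses of the factorization criterion with [A = W_{a+} L] and
[B = W_{a-} L]: a point of [W_{a-}] that lies in [W_{a++} L] is in [L]. *)
Lemma uniform_exists a V : cos V -> V `<=` plus a V *s plus a^-1 V ->
  exists2 T, cos T & forall n, (disp (a ^+ n) T = disp a T ^ n)%N.
Proof.
move=> cV V1; have sV := cos_sg cV; pose L := ell a V.
have sL : subgroup L := sg_ell a sV.
have fL : fin L V := fin_ell a cV.
pose V' := conj_core L V; have cV' : cos V' := cos_conj_core sL fL cV.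
pose P d := `[< exists N, disp a (pplus a N V') = d >].
have exP : exists d, P d by exists (disp a (pplus a 0 V')); apply/asboolP; exists 0%N.
case: (ex_minnP exP) => d /asboolP[N dN] dmin.
(* no later stage has a smaller displacement than the stage [N], so [W] factors *)
pose W := pplus a N V'; have cW : cos W := cos_pplus a N cV'.
have sW := cos_sg cW.
have WV' : W `<=` V' := @pplus_sub _ a N V'.
have V'V : V' `<=` V by move=> x /(_ 1 (sg1 sL)); rewrite !gE.
have W1 : W `<=` plus a W *s plus a^-1 W.
  apply: factor_plus_minus => // m; rewrite pplus_pplus dN; apply: dmin.
  by apply/asboolP; exists (m + N)%N.
have nW l x : L l -> W x -> W (l^-1 * x * l).
  move=> Ll Wx n nN m Lm; rewrite !autM autV.
  have := Wx n nN ((a^-1 ^+ n) l * m); rewrite !gE; apply.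
  by apply: (@sgM _ L) => //; have [] := ell_stableX n Ll.
have nWp l x : L l -> plus a W x -> plus a W (l^-1 * x * l).
  move=> Ll Wx n; rewrite !autM autV; apply: nW => //.
  by have [] := ell_stableX n Ll.
have nWm l x : L l -> plus a^-1 W x -> plus a^-1 W (l^-1 * x * l).
  move=> Ll Wx n; rewrite !autM autV; apply: nW => //.
  by rewrite invgK; have [] := ell_stableX n Ll.
have [sWp sWm] := (sg_plus a sW, sg_plus a^-1 sW).
have sT := sg_smul sW sL nW.
have [sA sB] := (sg_smul sWp sL nWp, sg_smul sWm sL nWm).
have cT : cos (W *s L).
  have oT : open (W *s L).
    by apply: (open_supsg sT sW); [case: cW|exact: smull].
  have [K cK LK] := ell_bounded a cV.
  have kW : compact W by case: cW.
  split=> //; apply: (subclosed_compact _ (compact_mul kW cK)).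
    exact: open_sg_closed.
  by move=> x [w Ww /LK Kx]; exists w => //; exists (w^-1 * x); rewrite ?gE.
exists (W *s L) => //.
apply: (uniform_of_factor cT sA sB).
- by move=> x [w Ww Lx]; exists w => //; exact: plus_sub Ww.
- by move=> x [w Ww Lx]; exists w => //; exact: plus_sub Ww.
- move=> x [w /W1[p Wp Wm] Lx]; exists p; first exact: smull.
  by exists (p^-1 * w) => //; move: Lx; rewrite !gE.
- move=> x [w Ww Lx]; exists (a^-1 w); first exact: plus_stable1.
  by rewrite -autV -autM; have [] := ell_stable Lx.
- move=> x [w Ww Lx]; exists (a w).
    by have := plus_stable1 Ww; rewrite invgK.
  by rewrite -autV -autM; have [] := ell_stable Lx.
move=> n x [p Wp Lp] [w Ww Lw].
pose z := (a ^+ n) p.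
have Lzx : L (z^-1 * x).
  have [+ _] := ell_stableX n Lp.
  by rewrite autM autV autXV.
have [q Wq Wm] := W1 _ Ww.
have Lm : L (q^-1 * w).
  split; last first.
    by apply: plus_plusplus; apply: plusS Wm => y /WV'/V'V.
  have sE := sg_plusplus a sV.
  have -> : q^-1 * w = q^-1 * z * ((z^-1 * x) * (w^-1 * x)^-1) by rewrite !gE.
  apply: (@sgM _ (plusplus a V)) => //; last first.
    by have [] := sgM sL Lzx (sgV sL Lw).
  apply: (@sgVM _ (plusplus a V)) => //.
    by apply: plus_plusplus; apply: plusS Wq => y /WV'/V'V.
  by exists n; rewrite /z autVX; apply: plusS Wp => y /WV'/V'V.
exists q => //; have -> : q^-1 * x = (q^-1 * w) * (w^-1 * x) by rewrite !gE.
exact: sgM.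
Qed.

End Tidying.

(** * Structure of tidy subgroups *)

Section TidyTheory.
Variable G : topologicalGroupType.
Implicit Types (a b c : topAut G) (A B C K L P U V W : set G) (x y g : G).

Lemma tidy_cos a V : tidy a V -> cos V. Proof. by case. Qed.

(** Compare with a subgroup [T] on which displacements are multiplicative: the
displacement of [T] is at least that of [V], and the displacements of the powers of
[a ^+ n] on [T] and on [V] are within a bounded factor. *)
Lemma tidy_uniform a V : tidy a V -> forall n, (disp (a ^+ n) V = disp a V ^ n)%N.
Proof.
move=> tV n; have [cV mV] := (tidyP a V).1 tV.
have [T cT uT] := uniform_exists cV (tidy_factor tV).
apply/eqP; rewrite eqn_leq disp_exp//=.
apply: (@leq_of_exp_bound _ _ (ind T V * ind V T)) => k.
rewrite -expnM (@leq_trans (disp a T ^ (n * k)))%N//.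
  by elim: (n * k)%N => // m IH; rewrite !expnS leq_mul// mV.
rewrite -uT (leq_trans (disp_change _ cT cV))// mulnAC leq_mul2l.
by rewrite expgnA disp_exp ?orbT.
Qed.

(** By the factorization of [V], the group [a V] is [a V_{a+}] up to elements of
[V]. *)
Lemma disp_plus a V : tidy a V ->
  fin (a @` plus a V) (plus a V) /\ ind (a @` plus a V) (plus a V) = disp a V.
Proof.
move=> tV; have cV := tidy_cos tV; have sV := cos_sg cV; have sp := sg_plus a sV.
have f1 : fin (a @` plus a V) V.
  by apply: fin_sub (fin_disp a cV); apply: img_autS; exact: plus_sub.
have [|||fp ep] := ind_same _ sV sp f1.
- exact: aut_sg.
- by move=> x []; rewrite img_autE => Vx Vx0 [|n] //; rewrite autXSr; exact: Vx.
- by move=> x [_ /plus_sub].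
split=> //; rewrite ep.
have [] // := @ind_prod _ (a @` V) (a @` plus a V) V sV.
- by apply: img_autS; exact: plus_sub.
- move=> _ [v /(tidy_factor tV)[y Vy Vyv] <-]; exists (a y); first by exists y.
  rewrite -autV -autM; have := Vyv 1%N; rewrite invgK; exact.
Qed.

(** The group [a^n V_{a+}] contains [V_{a+}] with index [disp a V ^ n], and meets
exactly [disp (a ^+ n) V] cosets of [V]. These numbers agree, so [a^n V_{a+}] meets
[V] in [V_{a+}] only. *)
Lemma tidy_plus_closed a V n x : tidy a V ->
  plus a V ((a^-1 ^+ n) x) -> V x -> plus a V x.
Proof.
move=> tV; have cV := tidy_cos tV; have sV := cos_sg cV; have sp := sg_plus a sV.
have [fp ep] := disp_plus tV.
have sE m : plus a V `<=` (a ^+ m) @` plus a V.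
  by move=> y Vy; rewrite img_autE -expVgn; exact: plus_stable.
have FE m : fin ((a ^+ m) @` plus a V) (plus a V) /\
    ind ((a ^+ m) @` plus a V) (plus a V) = (disp a V ^ m)%N.
  elim: m => [|m [fm em]].
    by rewrite img_aut1 ind_subset//; split=> //; exact: fin_subset.
  have f1 : fin ((a ^+ m.+1) @` plus a V) ((a ^+ m) @` plus a V).
    by rewrite expgSr img_autM; apply: fin_aut.
  split; first exact: fin_trans f1 fm.
  rewrite (@ind_mul _ _ ((a ^+ m) @` plus a V))//.
  - by rewrite em expnS expgSr img_autM ind_aut// ep.
  - exact: aut_sg.
  - exact: aut_sg.
  - by rewrite expgSr img_autM; apply: img_autS; exact: sE 1%N.
have [fn en] := FE n; pose X := (a ^+ n) @` plus a V; have sX : subgroup X by exact: aut_sg.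
have fXV : fin X V.
  by apply: fin_supr fn; exact: plus_sub.
have eX : ind X V = (disp a V ^ n)%N.
  rewrite -(tidy_uniform tV); symmetry.
  have [] // := @ind_prod _ ((a ^+ n) @` V) X V sV.
  - by apply: img_autS; exact: plus_sub.
  - move=> _ [v /(tidy_factor tV)[y Vy Vyv] <-]; exists ((a ^+ n) y); first by exists y.
    rewrite -autV -autM; have := Vyv n; rewrite invgK; exact.
have sXV := sgI sX sV.
have pX : plus a V `<=` X `&` V by move=> y Vy; split; [exact: sE|exact: plus_sub Vy].
have fI : fin (X `&` V) (plus a V) by apply: fin_sub fn => y [].
have XVp : X `&` V `<=` plus a V.
  apply: ind_le1 => //.
  have := ind_mul sX sXV sp pX (@subIsetl _ X V) (fin_interr sX sV fXV) fI.
  rewrite ind_interr// eX en -[X in X = _]muln1 => /eqP.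
  rewrite eqn_pmul2l ?expn_gt0 ?disp_gt0// => /eqP <- //.
by move=> Vx Vx0; apply: XVp; split=> //; rewrite /X img_autE -expVgn.
Qed.

(** The displacement of [a^-1] on [V] is the index of [V `&` a @` V] in [V]; the
quotient of the displacements of [a] and of [a^-1] is the factor by which [a]
scales Haar measure, the same on [V] and on [W]. *)
Lemma disp_inv_cross a V W : cos V -> cos W ->
  (disp a V * disp a^-1 W = disp a^-1 V * disp a W)%N.
Proof.
move=> cV cW.
have dinv U : cos U -> disp a^-1 U = ind U (a @` U).
  move=> cU; rewrite /disp -(ind_aut a (cos_sg cU)) ?img_autVK//.
  by apply: cos_fin => //; exact: cos_img.
pose I := (V `&` a @` V) `&` (W `&` a @` W).
have [cA cB] := (cos_img a cV, cos_img a cW).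
have cI : cos I by apply: cos_I; apply: cos_I.
have cr A B : cos A -> cos B -> I `<=` A `&` B ->
    (ind A B * ind B I = ind B A * ind A I)%N.
  move=> kA kB IAB; apply: ind_cross => //; try exact: cos_sg; try exact: cos_fin.
  by apply: cos_fin => //; exact: cos_I.
have eV := cr (a @` V) V cA cV.
have eW := cr (a @` W) W cB cW.
have eVW := cr V W cV cW.
have eaVW := cr (a @` V) (a @` W) cA cB.
have g A : cos A -> (0 < ind A I)%N.
  by move=> kA; apply: ind_gt0; [exact: cos_sg|exact: cos_sg|exact: cos_fin].
rewrite !dinv// /disp.
have i1 := eV (fun x '(conj (conj p q) r) => conj q p).
have i2 := eW (fun x '(conj r (conj p q)) => conj q p).
have i3 := eVW (fun x '(conj (conj p q) (conj r s)) => conj p r).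
have i4 := eaVW (fun x '(conj (conj p q) (conj r s)) => conj q s).
rewrite !ind_aut in i4; try exact: cos_sg; try exact: cos_fin.
have [[gV gW] [gA gB]] := ((g _ cV, g _ cW), (g _ cA, g _ cB)).
have gVW : (0 < ind V W)%N by apply: ind_gt0; [exact: cos_sg|exact: cos_sg|exact: cos_fin].
have gWV : (0 < ind W V)%N by apply: ind_gt0; [exact: cos_sg|exact: cos_sg|exact: cos_fin].
apply/eqP; rewrite -(@eqn_pmul2l (ind V I * ind (a @` W) I * ind V W * ind W V))%N; last first.
  by rewrite !muln_gt0 gV gB gVW gWV.
apply/eqP.
transitivity ((ind (a @` V) V * ind V I) * (ind W (a @` W) * ind (a @` W) I) *
  ind V W * ind W V)%N; first by lia.
rewrite i1 -i2.
transitivity (ind V (a @` V) * ind (a @` W) W * (ind V W * ind W I) *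
  (ind W V * ind (a @` V) I))%N; first by lia.
rewrite i3 -i4; lia.
Qed.

Lemma tidy_inv a V : tidy a V -> tidy a^-1 V.
Proof.
move=> /tidyP[cV mV]; apply/tidyP; split=> // W cW.
rewrite -(leq_pmul2l (disp_gt0 a cV)) (disp_inv_cross a cV cW) mulnC.
by rewrite leq_mul2l mV ?orbT.
Qed.

Lemma tidy_conj a c V : tidy a (c @` V) <-> tidy (c^-1 * a * c) V.
Proof.
have cE W : cos (c @` W) <-> cos W.
  by split=> [/(cos_img c^-1)|]; [rewrite img_autK|exact: cos_img].
have dE W : cos W -> disp (c^-1 * a * c) W = disp a (c @` W).
  move=> cW; rewrite /disp -(ind_aut c (cos_sg cW)); last exact: fin_disp.
  by rewrite -!img_autM !mulgA mulgV mul1g.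
split=> /tidyP[cV mV]; apply/tidyP.
  have cV' := (cE V).1 cV; split=> // W cW; rewrite !dE//.
  by apply: mV; exact: cos_img.
split; first exact: cos_img.
move=> W cW; rewrite -dE//.
have cW' : cos ((c^-1)%g @` W) by exact: cos_img.
by rewrite -[W](img_autVK c) -dE// mV.
Qed.

(** The parabolic subgroup of [a]: the points with relatively compact backward
orbit. Unlike [plus a V] it does not refer to a subgroup. *)
Definition par a := [set x | exists2 K, compact K & forall n, K ((a^-1 ^+ n) x)].

Lemma sg_par a : subgroup (par a).
Proof.
apply/subgroupP; split.
  by exists [set 1]; [exact: compact_set1|move=> n; rewrite aut1].
move=> x y [K cK Kx] [K' cK' Ky].
exists [set p * q | p in K & q in [set z^-1 | z in K']].
  by apply: compact_mul => //; exact: compact_inv.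
move=> n; exists ((a^-1 ^+ n) x) => //; exists (((a^-1 ^+ n) y)^-1).
  by exists ((a^-1 ^+ n) y).
by rewrite autM autV.
Qed.

Lemma plus_par a K : compact K -> plus a K `<=` par a.
Proof. by move=> cK x Kx; exists K. Qed.

Lemma par_stable a x : par a x -> par a (a x) /\ par a (a^-1 x).
Proof.
move=> [K cK Kx]; split.
  exists (K `|` [set a x]); first by apply: compactU => //; exact: compact_set1.
  by case=> [|n]; [right|left; rewrite autXSr autK].
by exists K => // n; rewrite -autXSr.
Qed.

Lemma par_stableX a n x : par a x -> par a ((a ^+ n) x) /\ par a ((a^-1 ^+ n) x).
Proof.
by move=> px; elim: n => // n [/par_stable[? _] /par_stable[_ ?]]; rewrite !autXS.
Qed.

(** The backward orbit of [v] meets finitely many cosets of [V]. By the pigeonhole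
principle two of its points, at times [i m < j m], are in the same coset; their
quotient is in [V], hence in [V_{a-}], and so the backward image of [v] after
[(j - i) m >= m] steps is in [V_{a-}]. Thus the whole backward orbit is in [V]. *)
Lemma minus_par_plus a V v : tidy a V -> plus a^-1 V v -> par a v -> plus a V v.
Proof.
move=> tV Vv [K cK Kv].
have tV' := tidy_inv tV; have cV := tidy_cos tV; have sV := cos_sg cV.
have sm := sg_plus a^-1 sV.
have [N [r rc]] : fin K V by apply: fin_compact_open => //; case: cV.
have big m : plus a^-1 V ((a^-1 ^+ m) v).
  have /choice[f fP] (i : 'I_N.+1) : exists t, V ((r t)^-1 * (a^-1 ^+ (i * m)) v).
    exact/rc/Kv.
  have /injectivePn[i [j ij fij]] : ~~ injectiveb f.
    by apply/injectiveP => /leq_card; rewrite !card_ord ltnn.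
  wlog lt_ij : i j ij fij / (i < j)%N.
    move=> W; have [|ji|/val_inj e] := ltngtP i j; first exact: W.
      by apply: (W j i) => //; rewrite eq_sym.
    by rewrite e eqxx in ij.
  have Vij : V (((a^-1 ^+ (i * m)) v)^-1 * (a^-1 ^+ (j * m)) v).
    have := sgVM sV (fP i); rewrite fij => /(_ _ (fP j)).
    by rewrite !gE.
  have im_jm : (i * m <= j * m)%N by rewrite leq_mul2r (ltnW lt_ij) orbT.
  have mij : plus a^-1 V (((a^-1 ^+ (i * m)) v)^-1 * (a^-1 ^+ (j * m)) v).
    apply: (@tidy_plus_closed a^-1 V (j * m)%N) => //.
    rewrite invgK autM autV autXV -{1}(subnK im_jm) autXD autXV.
    apply: (@sgVM _ (plus a^-1 V)) => //.
    by have := @plus_stable _ a^-1 V v (j * m - i * m)%N Vv; rewrite invgK.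
  have := @plus_stable _ a^-1 V _ (i * m)%N mij.
  rewrite invgK autM autV autXV autXBV// => /(sgM sm Vv); rewrite mulVKg => Vji.
  have mji : (m <= j * m - i * m)%N.
    by rewrite -mulnBl -[X in (X <= _)%N]mul1n leq_mul2r subn_gt0 lt_ij orbT.
  have := @plus_stable _ a^-1 V _ (j * m - i * m - m)%N Vji.
  by rewrite invgK autXBV ?leq_subr// subKn.
by move=> m; exact: plus_sub (big m).
Qed.

Lemma tidy_par a V : tidy a V -> V `&` par a = plus a V.
Proof.
move=> tV; have cV := tidy_cos tV; have sV := cos_sg cV.
rewrite eqEsubset; split=> [x [Vx px]|x Vx]; last first.
  split; first exact: plus_sub Vx.
  by apply: plus_par Vx; case: cV.
have [y Vy Vyx] := tidy_factor tV Vx.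
have py : par a y by apply: plus_par Vy; case: cV.
rewrite -[x](mulVKg y); apply: (@sgM _ (plus a V)) => //; first exact: sg_plus.
apply: minus_par_plus => //; exact: (sgVM (sg_par a)).
Qed.

Lemma tidy_parV a V : tidy a V -> V `&` par a^-1 = plus a^-1 V.
Proof. by move=> /tidy_inv/tidy_par. Qed.

(** Only the factorization of [U `&` V] is at stake. Write a point as
[u u' = v v'] along the factorizations of [U] and [V]. Then [m = v^-1 u] has a
relatively compact orbit in both directions. Backward images of [V_{a+}] shrink to
[V_0 = V_{a+} `&` V_{a-}], so a backward image of [m] is a product of elements of
[V_0] and of [U_0]; these groups are stable under [a], so [m] itself is such a
product [p q], and [u q^-1 = v p] is in both [U_{a+}] and [V_{a+}]. *)
Lemma tidyI a U V : tidy a U -> tidy a V -> tidy a (U `&` V).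
Proof.
move=> tU tV; have [cU cV] := (tidy_cos tU, tidy_cos tV).
have [sU sV] := (cos_sg cU, cos_sg cV).
have cW := cos_I cU cV; have sW := cos_sg cW.
have [sUp sVp] := (sg_plus a sU, sg_plus a sV).
have [sUm sVm] := (sg_plus a^-1 sU, sg_plus a^-1 sV).
pose M := par a `&` par a^-1; have sM : subgroup M by apply: sgI; exact: sg_par.
have MX n x : M x -> M ((a ^+ n) x) /\ M ((a^-1 ^+ n) x).
  move=> [/(par_stableX n)[p1 p2] /(par_stableX n)[p3 p4]].
  by move: p3 p4; rewrite invgK => p3 p4; split; split.
have M0 Z x : tidy a Z -> M x -> Z x -> plus a Z x /\ plus a^-1 Z x.
  by move=> tZ [px qx] Zx; rewrite -tidy_par// -tidy_parV.
pose V0 := plus a V `&` plus a^-1 V.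
have pE : plus a (U `&` V) = plus a U `&` plus a V.
  rewrite eqEsubset; split=> x Wx; first by split=> n; have [] := Wx n.
  by move=> n; split; [exact: Wx.1|exact: Wx.2].
have mE : plus a^-1 (U `&` V) = plus a^-1 U `&` plus a^-1 V.
  rewrite eqEsubset; split=> x Wx; first by split=> n; have [] := Wx n.
  by move=> n; split; [exact: Wx.1|exact: Wx.2].
(* the backward images of [V_{a+}] decrease to [V_0], inside the open set [V_0 W] *)
have [N NP] : exists n, V `&` (a^-1 ^+ n) @` plus a V `<=` V0 *s (U `&` V).
  apply: compact_decreasing_open.
  - by case: cV.
  - by apply: open_smul; case: cW.
  - by move=> n; apply: closed_img; apply: closed_plus; exact: cos_closed.
  - move=> n x; rewrite !img_autE -!expVgn !invgK autXSr => Vx.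
    by have := plus_stable1 Vx; rewrite -autXSr autXS autK.
  - move=> x Vx Ex; exists x; last by rewrite mulVg; exact: sg1.
    split=> [|n].
      by have := Ex 0%N; rewrite img_autE.
    have := Ex n; rewrite img_autE -!expVgn !invgK; exact: plus_sub.
have fac : U `&` V `<=` plus a (U `&` V) *s plus a^-1 (U `&` V).
  move=> x [Ux Vx].
  have [u Uu Uux] := tidy_factor tU Ux; have [v Vv Vvx] := tidy_factor tV Vx.
  have kU : compact U by case: cU.
  have kV : compact V by case: cV.
  pose m := v^-1 * u.
  have Mm : M m.
    split; first by apply: sgVM; [exact: sg_par|exact: plus_par Vv|exact: plus_par Uu].
    have -> : m = (v^-1 * x) * (u^-1 * x)^-1 by rewrite /m !gE.
    apply: sgM; first exact: sg_par.
      exact: plus_par Vvx.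
    by apply: sgV; [exact: sg_par|exact: plus_par Uux].
  have [p [Vp Vp'] [Up Vp'']] : (V0 *s (U `&` V)) ((a^-1 ^+ N) v^-1).
    have Vv' : plus a V v^-1 by exact: (sgV sVp Vv).
    apply: NP; split; first exact: Vv'.
    by rewrite img_autE expVgn autVK.
  have Mp : M p by split; [exact: plus_par Vp|exact: plus_par Vp'].
  pose q := p^-1 * (a^-1 ^+ N) m.
  have Mq : M q by apply: (@sgVM _ M) => //; have [] := MX N _ Mm.
  have Uq : U q.
    have -> : q = (p^-1 * (a^-1 ^+ N) v^-1) * (a^-1 ^+ N) u by rewrite /q /m autM mulgA.
    by apply: sgM => //; exact: Uu.
  pose p' := (a ^+ N) p; pose q' := (a ^+ N) q.
  have mpq : m = p' * q' by rewrite /p' /q' -autM /q mulVKg autXV.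
  have st Z y : tidy a Z -> M y -> Z y -> plus a Z ((a ^+ N) y) /\ plus a^-1 Z ((a ^+ N) y).
    move=> tZ My Zy; have [My' _] := MX N _ My.
    apply: (M0 Z) => //; have [_ /(_ N)] := M0 Z y tZ My Zy.
    by rewrite invgK.
  have [Vp1 Vp2] := st V p tV Mp (plus_sub Vp).
  have [Uq1 Uq2] := st U q tU Mq Uq.
  have e : u * q'^-1 = v * p'.
    have -> : u = v * m by rewrite /m !gE.
    by rewrite mpq !gE.
  exists (u * q'^-1).
    rewrite pE; split; last by rewrite e; exact: (sgM sVp).
    by apply: (sgM sUp) => //; exact: (sgV sUp).
  rewrite mE; split; last by rewrite e invgM mulgAr; exact: (sgVM sVm).
  by rewrite invgM invgK mulgAr; exact: (sgM sUm).
apply: (tidy_of_factor cW (sg_plus a sW) (sg_plus a^-1 sW)) => //.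
- exact: plus_sub.
- exact: plus_sub.
- exact: plus_stable1.
- by move=> x /plus_stable1; rewrite invgK.
- move=> n x; rewrite pE => -[Ux Vx] [Ux0 Vx0].
  by split; [exact: tidy_plus_closed Ux Ux0|exact: tidy_plus_closed Vx Vx0].
Qed.

End TidyTheory.

(** * Limits of commonly tidy subgroups *)

Section TidyIntersections.
Variable G : topologicalGroupType.
Implicit Types (a b c : topAut G) (A C D K L P S T U V W : set G).

Variables (H B : set (topAut G)).
Hypotheses (sH : subgroup H) (BH : B `<=` H).
Hypothesis BV : forall b, B b -> B b^-1.
Hypothesis BJ : forall h b, H h -> B b -> B (h * b * h^-1).

Definition common_tidy T := cos T /\ tidy_for B T.

Lemma common_tidyI S T : common_tidy S -> common_tidy T -> common_tidy (S `&` T).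
Proof.
move=> [cS tS] [cT tT]; split; first exact: cos_I.
by move=> b Bb; apply: tidyI; [exact: tS|exact: tT].
Qed.

Lemma common_tidy_img h T : H h -> common_tidy T -> common_tidy (h @` T).
Proof.
move=> Hh [cT tT]; split; first exact: cos_img.
move=> b Bb; apply/tidy_conj; apply: tT.
by rewrite -{2}[h]invgK; apply: BJ => //; exact: sgV.
Qed.

Lemma common_tidy_pplus b m T : B b -> common_tidy T -> common_tidy (pplus b m T).
Proof.
move=> Bb fT; elim: m => [|m IH]; first by rewrite pplus0.
rewrite pplusSr; apply: common_tidyI => //; apply: common_tidy_img => //.
have Hb := BH Bb; elim: (m.+1) => [|n IHn]; first exact: sg1.
by rewrite expgS; exact: (sgM sH).
Qed.

(** The closed subgroups that are limits of decreasing sequences of subgroups tidy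
for all of [B]. Sequences suffice because [plus b C] is again such a limit, along
the diagonal. *)
Definition tidy_limit C := exists T : nat -> set G,
  [/\ forall n, common_tidy (T n), forall n, T n.+1 `<=` T n &
      C = [set x | forall n, T n x]].

Lemma dec_le (T : nat -> set G) m n : (forall n, T n.+1 `<=` T n) ->
  (m <= n)%N -> T n `<=` T m.
Proof.
move=> dT; elim: n => [|n IH]; first by rewrite leqn0 => /eqP ->.
by rewrite leq_eqVlt => /predU1P[->//|]; rewrite ltnS => /IH mn x /dT/mn.
Qed.

Lemma common_tidy_limit T : common_tidy T -> tidy_limit T.
Proof.
move=> fT; exists (fun=> T); split; [by []|by move=> n x|].
by rewrite eqEsubset; split=> [x Tx n|x /(_ 0%N)].
Qed.

Lemma tidy_limitI C D : tidy_limit C -> tidy_limit D -> tidy_limit (C `&` D).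
Proof.
move=> [S [fS dS ->]] [T [fT dT ->]]; exists (fun n => S n `&` T n); split.
- by move=> n; exact: common_tidyI.
- by move=> n x [/dS ? /dT ?].
- rewrite eqEsubset; split=> x Cx; first by split; [exact: Cx.1|exact: Cx.2].
  by split=> n; have [] := Cx n.
Qed.

Lemma tidy_limit_img h C : H h -> tidy_limit C -> tidy_limit (h @` C).
Proof.
move=> Hh [T [fT dT ->]]; exists (fun n => h @` T n); split.
- by move=> n; exact: common_tidy_img.
- by move=> n; apply: img_autS.
- rewrite img_aut eqEsubset; split=> x Cx n; have := Cx n; by rewrite img_autE.
Qed.

Lemma tidy_limit_plus b C : B b -> tidy_limit C -> tidy_limit (plus b C).
Proof.
move=> Bb [T [fT dT ->]]; exists (fun n => pplus b n (T n)); split.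
- by move=> n; exact: common_tidy_pplus.
- by move=> n x Tx k kn; apply: dT; apply: Tx; exact: leqW.
- rewrite eqEsubset; split=> x Cx; first by move=> n k _; exact: Cx.
  move=> k n; have := Cx (maxn n k) k (leq_maxr _ _).
  by apply: dec_le => //; exact: leq_maxl.
Qed.

Lemma tidy_limit_sg C : tidy_limit C -> subgroup C.
Proof.
move=> [T [fT _ ->]]; apply/subgroupP; split=> [n|x y Cx Cy n].
  by have [[sT _ _] _] := fT n; exact: sg1.
by have [[sT _ _] _] := fT n; apply: sgM => //; exact: sgV.
Qed.

Lemma tidy_limit_closed C : tidy_limit C -> closed C.
Proof.
move=> [T [fT _ ->]]; have -> : [set x | forall n, T n x] = \bigcap_(n in [set: nat]) T n.
  by rewrite eqEsubset; split=> x Cx n //; exact: Cx.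
by apply: closed_bigI => n _; apply: cos_closed; case: (fT n).
Qed.

Lemma tidy_limit_compact C : tidy_limit C -> compact C.
Proof.
move=> lC; have clC := tidy_limit_closed lC; have [T [fT _ eC]] := lC.
have [[_ kT _] _] := fT 0%N; apply: (subclosed_compact clC kT).
by rewrite eC => x /(_ 0%N).
Qed.

Lemma tidy_limit_par b C : B b -> tidy_limit C -> C `&` par b = plus b C.
Proof.
move=> Bb lC; have kC := tidy_limit_compact lC; move: lC kC => [T [fT _ ->]] kC.
rewrite eqEsubset; split=> [x [Cx px] k n|x Cx]; last first.
  by split; [exact: plus_sub Cx|exact: plus_par Cx].
have : plus b (T n) x; last exact.
by rewrite -tidy_par; [split; [exact: Cx|]|apply: (fT n).2].
Qed.

(** The factors of [x] in the approximating tidy subgroups form decreasing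
nonempty compact sets. *)
Lemma tidy_limit_factor b C : B b -> tidy_limit C -> C `<=` plus b C *s plus b^-1 C.
Proof.
move=> Bb [T [fT dT ->]] x Cx.
have [cT tT] := (fun n => (fT n).1, fun n => (fT n).2).
pose E n := plus b (T n) `&` [set y | plus b^-1 (T n) (y^-1 * x)].
have [||||y _ Ey] := @compact_decreasing _ (T 0%N) E.
- by case: (cT 0%N).
- move=> n; have clT := cos_closed (cT n).
  by apply: closedI; [exact: closed_plus|apply: closed_quot; exact: closed_plus].
- by move=> n y [Ty Tyx]; split; [exact: plusS (dT n) _ Ty|exact: plusS (dT n) _ Tyx].
- move=> n; have [y Ty Tyx] := tidy_factor (tT n b Bb) (Cx n).
  exists y; split; last by split.
  by apply: (dec_le dT (leq0n n)); exact: plus_sub Ty.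
by exists y => k n; have [Ty Tyx] := Ey n; [exact: Ty|exact: Tyx].
Qed.

Lemma tidy_limit_disp_plus b C : B b -> tidy_limit C ->
  (fin (b @` C) C <-> fin (b @` plus b C) (plus b C)) /\
  (fin (b @` C) C -> ind (b @` plus b C) (plus b C) = disp b C).
Proof.
move=> Bb lC; have sC := tidy_limit_sg lC; have sp := sg_plus b sC.
have cl x : (b @` plus b C) x -> C x -> plus b C x.
  by rewrite img_autE => Cx Cx0 [|n] //; rewrite autXSr; exact: Cx.
have f1 : fin (b @` plus b C) C ->
    fin (b @` plus b C) (plus b C) /\ ind (b @` plus b C) (plus b C) = ind (b @` plus b C) C.
  move=> f; apply: ind_same => //; first exact: aut_sg.
  - by move=> x []; exact: cl.
  - by move=> x [_ /plus_sub].
have f2 : fin (b @` plus b C) C ->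
    fin (b @` C) C /\ ind (b @` C) C = ind (b @` plus b C) C.
  apply: ind_prod => //; first by apply: img_autS; exact: plus_sub.
  move=> _ [v /(tidy_limit_factor Bb lC)[y Cy Cyv] <-]; exists (b y); first by exists y.
  by rewrite -autV -autM; have := Cyv 1%N; rewrite invgK; exact.
have f3 : fin (b @` C) C -> fin (b @` plus b C) C.
  by apply: fin_sub; apply: img_autS; exact: plus_sub.
split; first split.
- by move=> /f3/f1[].
- by move=> f; have [] // := f2 (fin_supr (@plus_sub _ b C) f).
- by move=> f; rewrite /disp (f1 (f3 f)).2 (f2 (f3 f)).2.
Qed.

(** With [E = D `&` T], the group [plus b E] has finite index in [plus b D], and the
same index between the images by [b]; the index of [plus b E] in [b @` plus b D]
can be computed through either of the two intermediate groups. *)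
Lemma tidy_limit_disp_cut b D T : B b -> tidy_limit D -> common_tidy T -> fin (b @` D) D ->
  fin (b @` (D `&` T)) (D `&` T) /\ disp b (D `&` T) = disp b D.
Proof.
move=> Bb lD fT fD; have lE : tidy_limit (D `&` T).
  by apply: tidy_limitI => //; exact: common_tidy_limit.
have [cT tT] := fT; have sT := cos_sg cT.
have [iffD eD] := tidy_limit_disp_plus Bb lD; have [iffE eE] := tidy_limit_disp_plus Bb lE.
have lDp := tidy_limit_plus Bb lD; have lEp := tidy_limit_plus Bb lE.
have [sD sE] := (tidy_limit_sg lDp, tidy_limit_sg lEp).
have EE : plus b (D `&` T) = plus b D `&` T.
  by rewrite -!tidy_limit_par// setIAC.
have fDT : fin (plus b D) T.
  by apply: fin_compact_open => //; [exact: tidy_limit_compact|case: cT].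
have fDE : fin (plus b D) (plus b (D `&` T)) by rewrite EE; exact: fin_interr.
have ED : plus b (D `&` T) `<=` plus b D by rewrite EE => x [].
have up C : tidy_limit C -> plus b C `<=` b @` plus b C.
  by move=> lC x Cx; rewrite img_autE; exact: plus_stable1.
have fDD := iffD.1 fD.
have f1 := fin_trans fDD fDE.
have f2 : fin (b @` plus b (D `&` T)) (plus b (D `&` T)).
  by apply: fin_sub f1; exact: img_autS.
have fE := iffE.2 f2; split=> //; rewrite -eE// -eD//.
have := ind_mul (aut_sg b sD) sD sE ED (up _ lD) fDD fDE.
rewrite (ind_mul (aut_sg b sD) (aut_sg b sE) sE (up _ lE) (img_autS ED) (fin_aut b sE fDE) f2).
rewrite (ind_aut b sE fDE) mulnC => /eqP.
by rewrite eqn_pmul2r ?ind_gt0// => /eqP.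
Qed.

(** Finitely many elements of [b @` C] distinct modulo [C] are distinct modulo one
of the tidy subgroups [T N] decreasing to [C], hence modulo [D `&` T N], which has
the same displacement as [D]. *)
Lemma tidy_limit_disp_sub b C D : B b -> tidy_limit C -> tidy_limit D -> C `<=` D ->
  fin (b @` D) D -> fin (b @` C) C /\ (disp b C <= disp b D)%N.
Proof.
move=> Bb lC lD CD fD; have sC := tidy_limit_sg lC; have [T [fT dT eC]] := lC.
have bound n (r : 'I_n -> G) : separated_mod (b @` C) C r -> (n <= disp b D)%N.
  move=> [rb rC].
  have [N NP] : exists N, forall i j : 'I_n, T N ((r i)^-1 * r j) -> C ((r i)^-1 * r j).
    have /choice[f fP] (p : 'I_n * 'I_n) : exists N,
        T N ((r p.1)^-1 * r p.2) -> C ((r p.1)^-1 * r p.2).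
      apply: contrapT => /forallNP nN.
      have : C ((r p.1)^-1 * r p.2).
        by rewrite eC => N; have /not_implyP[] := nN N.
      by move=> Cp; apply: (nN 0%N).
    exists (\max_p f p)%N => i j Tij; apply: (fP (i, j)).
    by apply: dec_le Tij => //; exact: (@leq_bigmax _ f (i, j)).
  have [fE <-] := tidy_limit_disp_cut Bb lD (fT N) fD.
  have sE : subgroup (D `&` T N).
    by apply: sgI; [exact: tidy_limit_sg|apply: cos_sg; case: (fT N)].
  rewrite -[X in (X <= _)%N]card_ord; apply: (separated_le_ind (r := r) sE fE).
  split=> [i|i j [_ /NP]]; last exact: rC.
  by apply: img_autS (rb i) => x Cx; split; [exact: CD|move: Cx; rewrite eC; exact].
have [n [r [rs rc]]] := separated_bound sC bound.
split; first exact: fin_covers rc.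
by rewrite /disp (ind_eq sC rs rc) card_ord; exact: bound rs.
Qed.

Lemma tidy_limit_fin b C : B b -> tidy_limit C -> fin (b @` C) C.
Proof.
move=> Bb lC; have [T [fT _ eC]] := lC.
have [] // := tidy_limit_disp_sub Bb lC (common_tidy_limit (fT 0%N)).
- by rewrite eC => x /(_ 0%N).
- by apply: fin_disp; case: (fT 0%N).
Qed.

Lemma tidy_limit_disp_le b C D : B b -> tidy_limit C -> tidy_limit D -> C `<=` D ->
  (disp b C <= disp b D)%N.
Proof.
by move=> Bb lC lD CD; have [] := tidy_limit_disp_sub Bb lC lD CD (tidy_limit_fin Bb lD).
Qed.

Lemma tidy_limit_sub_img b C : B b -> tidy_limit C -> C `<=` par b -> C `<=` b @` C.
Proof.
move=> Bb lC Cp x Cx; rewrite img_autE.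
have : plus b C x by rewrite -tidy_limit_par//; split=> //; exact: Cp.
by move=> /plus_stable1/plus_sub.
Qed.

Lemma tidy_limit_par_of_sub b C : B b -> tidy_limit C -> C `<=` b @` C -> C `<=` par b.
Proof.
move=> Bb lC Cb x Cx; apply: (plus_par (tidy_limit_compact lC)) => n.
elim: n => // n IH; rewrite autXS -img_autE; exact: Cb.
Qed.

Lemma tidy_limit_fixed b C : B b -> tidy_limit C -> C `<=` par b -> (disp b C <= 1)%N ->
  b @` C = C.
Proof.
move=> Bb lC Cp d1; have sC := tidy_limit_sg lC.
rewrite eqEsubset; split; last exact: tidy_limit_sub_img.
by apply: ind_le1 => //; [exact: aut_sg|exact: tidy_limit_fin].
Qed.

(** The part [D = plus b^-1 C] of [C] contracted by [b] has a subgroup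
[D `&` T] of finite index fixed by [b], so its displacement under [b^-1] is [1] and
it is fixed by [b]. *)
Lemma par_cut b C T : B b -> tidy_limit C -> common_tidy T ->
  C `&` T `<=` par b -> C `<=` par b.
Proof.
move=> Bb lC fT CTp; have Bb' := BV Bb.
have sp := sg_par b.
have lm := tidy_limit_plus Bb' lC.
pose D := plus b^-1 C.
have DC : D `<=` C by exact: plus_sub.
have lDT : tidy_limit (D `&` T) by apply: tidy_limitI => //; exact: common_tidy_limit.
have Dp : D `<=` par b^-1 by rewrite /D -tidy_limit_par// => x [].
have DTp : D `&` T `<=` par b by move=> x [/DC Cx Tx]; exact: CTp.
have fix1 : b @` (D `&` T) = D `&` T.
  rewrite eqEsubset; split; last exact: tidy_limit_sub_img.
  move=> _ [x xDT <-]; have : (b^-1)%g @` (D `&` T) `<=` (b^-1)%g @` (b @` (D `&` T)).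
    by apply: img_autS; exact: tidy_limit_sub_img.
  have := @tidy_limit_sub_img b^-1 (D `&` T) Bb' lDT.
  move=> /(_ _ x xDT); rewrite img_autE invgK => h _; apply: h => y [/Dp].
  exact.
have d1 : (disp b^-1 D <= 1)%N.
  have [_ <-] := tidy_limit_disp_cut Bb' lm fT (tidy_limit_fin Bb' lm).
  rewrite /disp -{1}fix1 img_autK ind_subset//; exact: tidy_limit_sg.
have fixD : (b^-1)%g @` D = D := tidy_limit_fixed Bb' lm Dp d1.
have fixD' : b @` D = D by rewrite -{1}fixD img_autVK.
have Dpar : D `<=` par b.
  by apply: tidy_limit_par_of_sub => //; rewrite fixD'.
move=> x Cx; have [y Cy Cyx] := tidy_limit_factor Bb lC Cx.
rewrite -[x](mulVKg y); apply: (sgM sp); last exact: Dpar.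
by move: Cy; rewrite -tidy_limit_par// => -[].
Qed.

(** * Decomposition into irreducible subgroups *)

Section Strictness.
Variable Y : seq (topAut G).
Hypothesis YB : forall y, y \in Y -> B y.
Hypothesis Ygen : forall K : set G, (forall y, y \in Y -> y @` K = K) ->
  forall h, H h -> h @` K = K.

Lemma exists_uniform_index (P : topAut G -> nat -> Prop) (l : seq (topAut G)) :
  (forall y, y \in l -> exists n, forall m, (n <= m)%N -> P y m) ->
  exists n, forall y, y \in l -> P y n.
Proof.
move=> lP; suff [n nP] : exists n, forall m, (n <= m)%N -> forall y, y \in l -> P y m.
  by exists n => y; exact: nP.
elim: l lP => [|y l IH] lP; first by exists 0%N.
have [|n nP] := IH; first by move=> z zl; apply: lP; rewrite inE zl orbT.
have [k kP] := lP y (mem_head _ _).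
exists (maxn n k) => m; rewrite geq_max => /andP[nm km] z.
by rewrite inE => /predU1P[->|zl]; [exact: kP|exact: nP].
Qed.

(** Suppose that [A <= C] have the same displacements under the generators, which
all expand [C]. Cutting [C] by a tidy subgroup close to [A] gives a subgroup [C1]
with [C1 = A (y^-1 C1)] for each generator [y]. Iterating for one generator [x]
gives [C1 = A Z], where [Z] is the part of [C1] fixed by [x]; by the equalities
above [Z = (A `&` Z) (y^-1 Z)], so the pair [A `&` Z <= Z] satisfies the same
hypotheses with one more generator acting trivially. When all the generators fix
[C], so does [b]. *)
Lemma par_of_equal_disp_aux (l : seq (topAut G)) A C b :
  tidy_limit A -> tidy_limit C -> A `<=` C ->
  (forall y, y \in Y -> C `<=` par y) ->
  (forall y, y \in Y -> (disp y C <= disp y A)%N) ->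
  (forall y, y \in Y -> y \in l \/ y @` C = C) ->
  B b -> A `<=` par b -> C `<=` par b.
Proof.
elim: l A C => [|x l IH] A C lA lC AC Cp dCA Yl Bb Ap.
  apply: tidy_limit_par_of_sub => //; rewrite (Ygen (K := C)) => // [y yY|]; last exact: BH.
  by have [] := Yl y yY.
have [xY|xY] := boolP (x \in Y); last first.
  apply: (IH A C) => // y yY; have [|?] := Yl y yY; last by right.
  rewrite inE => /predU1P[yx|]; last by left.
  by rewrite -yx yY in xY.
have [T [fT dT eA]] := lA; have sA := tidy_limit_sg lA.
(* [y A] consists of finitely many cosets of [A], all but [A] avoided by small [T n] *)
have [n nP] : exists n, forall y, y \in Y -> y @` A `&` T n `<=` A.
  apply: exists_uniform_index => y yY; have By := YB yY.
  have [m [r [[rb rA] rc]]] := fin_transversal sA (tidy_limit_fin By lA).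
  have /choice[f fP] (i : 'I_m) : exists N, T N (r i) -> A (r i).
    apply: contrapT => /forallNP nN.
    have Ai : A (r i) by rewrite eA => N; have /not_implyP[] := nN N.
    by apply: (nN 0%N).
  exists (\max_i f i)%N => k fk z [zA Tz].
  have [i Ai] := rc z zA.
  have sT : subgroup (T k) by apply: cos_sg; case: (fT k).
  have Ti : T k (r i).
    rewrite -[r i]mulg1 -(mulVg z) mulgA.
    have Az : A (z^-1 * r i) by have := sgV sA Ai; rewrite !gE.
    have -> : r i * z^-1 * z = z * (z^-1 * r i) by rewrite !gE.
    by apply: sgM => //; move: Az; rewrite eA; exact.
  have /fP Ari : T (f i) (r i).
    by apply: dec_le Ti => //; apply: leq_trans fk; exact: (@leq_bigmax _ f i).
  by have := sgM sA Ari Ai; rewrite !gE.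
pose C1 := C `&` T n.
have lC1 : tidy_limit C1 by apply: tidy_limitI => //; exact: common_tidy_limit.
have sC1 := tidy_limit_sg lC1.
have AC1 : A `<=` C1 by move=> z Az; split; [exact: AC|move: Az; rewrite eA; exact].
have C1p y : y \in Y -> C1 `<=` par y by move=> yY z [/(Cp y yY)].
have C1A y : y \in Y -> y @` C1 `<=` (y @` A) *s C1.
  move=> yY; have By := YB yY; apply: ind_ge_prod => //.
  - exact: tidy_limit_fin.
  - exact: img_autS.
  have [_ e1] := tidy_limit_disp_cut By lC (fT n) (tidy_limit_fin By lC).
  have [] // := @ind_same _ (y @` A) A C1 _ sA sC1 (tidy_limit_fin By lA).
  - exact: aut_sg.
  - by move=> z [_ /AC1].
  - by move=> z [zA [_ Tz]]; apply: (nP y yY).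
  by move=> _ ->; rewrite -/(disp y C1) e1; exact: dCA.
have C1A' y z : y \in Y -> C1 z -> exists2 a, A a & C1 (y (a^-1 * z)).
  move=> yY Cz; have [|a] := C1A y yY (y z); first by exists z.
  rewrite img_autE => Aa Caz; exists (y^-1 a) => //.
  by rewrite autM autV autVK.
have Astab y z k : y \in Y -> A z -> A ((y^-1 ^+ k) z).
  move=> yY Az; have : plus y A z.
    by rewrite -tidy_limit_par//; [split=> //; apply: (Cp y yY); exact: AC|exact: YB].
  by move=> /(@plus_stable _ _ _ _ k)/plus_sub.
have Bx := YB xY; have Bx' := BV Bx.
pose Z := plus x^-1 C1.
have lZ : tidy_limit Z by exact: tidy_limit_plus.
have C1AZ z : C1 z -> exists2 a, A a & Z (a^-1 * z).
  move=> Cz.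
  (* iterate [C1 = A (x^-1 C1)], using that [x^-1] maps [A] into itself *)
  have it k : exists2 a, A a & C1 ((x ^+ k) (a^-1 * z)).
    elim: k => [|k [a Aa Ca]]; first by exists 1; rewrite ?gE//; exact: sg1.
    have [a' Aa' Ca'] := C1A' x _ xY Ca.
    exists (a * (x^-1 ^+ k) a'); first by apply: sgM => //; exact: Astab.
    by rewrite invgM mulgAr autXS autM autV autXV.
  pose E k := A `&` [set a | C1 ((x ^+ k) (a^-1 * z))].
  have [||||a Aa Ea] := @compact_decreasing _ C1 E.
  - exact: tidy_limit_compact.
  - move=> k; apply: closedI; first exact: tidy_limit_closed.
    have := @closed_quot _ z [set w | C1 ((x ^+ k) w)]; apply.
    by have := @closed_img _ (x ^- k) _ (tidy_limit_closed lC1); rewrite img_aut invgK.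
  - move=> k a [Aa Ca]; split=> //.
    have : plus x C1 ((x ^+ k.+1) (a^-1 * z)).
      by rewrite -tidy_limit_par//; split=> //; exact: C1p.
    by rewrite autXS => /plus_stable1/plus_sub; rewrite autK.
  - by move=> k; have [a Aa Ca] := it k; exists a; split=> //; exact: AC1.
  exists a; first by have [] := Ea 0%N.
  by move=> k; rewrite invgK; have [] := Ea k.
have ZC1 : Z `<=` C1 by exact: plus_sub.
have xZ : x @` Z = Z.
  have Zp : Z `<=` par x by move=> z /ZC1; exact: C1p.
  rewrite eqEsubset; split; last exact: tidy_limit_sub_img.
  by move=> z; rewrite img_autE => /plus_stable1; rewrite invgK autVK.
have lAZ : tidy_limit (A `&` Z) by exact: tidy_limitI.
have Zpar : Z `<=` par b.
  apply: (IH (A `&` Z) Z) => //.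
  - by move=> y yY z /ZC1; exact: C1p.
  - move=> y yY; have By := YB yY; have sZ := tidy_limit_sg lZ; have sAZ := tidy_limit_sg lAZ.
    apply: (@leq_trans (ind (y @` (A `&` Z)) Z)); last first.
      by apply: ind_supr => //; exact: tidy_limit_fin.
    have fAZ : fin (y @` (A `&` Z)) Z.
      by apply: fin_sub (tidy_limit_fin By lZ); exact: img_autS.
    have yAZ : y @` (A `&` Z) `<=` y @` Z by exact: img_autS.
    have [|_ <-] // := ind_prod sZ yAZ _ fAZ.
    move=> _ [z Zz <-].
    have [a Aa Ca] := C1A' y z yY (ZC1 z Zz).
    have [a' Aa' Za'] := C1AZ _ Ca.
    pose d := a * y^-1 a'.
    have Ad : A d by apply: sgM => //; exact: (Astab y a' 1%N).
    have Zd : Z (y (d^-1 * z)).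
      by rewrite /d invgM mulgAr autM autV autVK.
    have Zd' : Z (d^-1 * z).
      have : plus y Z (y (d^-1 * z)).
        by rewrite -tidy_limit_par//; split=> //; apply: C1p => //; exact: ZC1.
      by move=> /plus_stable1/plus_sub; rewrite autK.
    exists (y d); last by rewrite -autV -autM.
    exists d => //; split=> //.
    by have := sgM sZ Zz (sgV sZ Zd'); rewrite !gE.
  - move=> y yY; have By := YB yY; have [|yC] := Yl y yY.
      by rewrite inE => /predU1P[->|yl]; [right|left].
    right; apply: tidy_limit_fixed => //; first by move=> z /ZC1; exact: C1p.
    have sC := tidy_limit_sg lC.
    have <- : disp y C = 1%N by rewrite /disp yC ind_subset.
    by apply: tidy_limit_disp_le => // z /ZC1[].
  - by move=> z [/Ap].
apply: (par_cut Bb lC (fT n)) => z /C1AZ[a /Ap pa /Zpar paz].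
by have := sgM (sg_par b) pa paz; rewrite !gE.
Qed.

Lemma par_of_equal_disp A C b : tidy_limit A -> tidy_limit C -> A `<=` C ->
  (forall y, y \in Y -> C `<=` par y) ->
  (forall y, y \in Y -> (disp y C <= disp y A)%N) ->
  B b -> A `<=` par b -> C `<=` par b.
Proof.
by move=> *; apply: (@par_of_equal_disp_aux Y A) => // y yY; left.
Qed.

(** No element of [B] splits [C] into two proper factors, one expanded and one
contracted. *)
Definition irreducible C := tidy_limit C /\
  forall b, B b -> C `<=` par b \/ C `<=` par b^-1.

Lemma sum_disp_lt A C : tidy_limit A -> tidy_limit C -> A `<=` C ->
  ~ (forall y, y \in Y -> (disp y C <= disp y A)%N) ->
  (\sum_(y <- Y) disp y A < \sum_(y <- Y) disp y C)%N.
Proof.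
move=> lA lC AC; apply: contra_notT; rewrite -leqNgt => le y yY.
have leY z : z \in Y -> (disp z A <= disp z C)%N.
  by move=> zY; apply: tidy_limit_disp_le => //; exact: YB.
move: le; rewrite !(perm_big _ (perm_to_rem yY))/= !big_cons => le.
have : (\sum_(z <- rem y Y) disp z A <= \sum_(z <- rem y Y) disp z C)%N.
  by rewrite !big_seq; apply: leq_sum => z /mem_rem; exact: leY.
by move=> /(leq_add (leqnn (disp y A)))/(leq_trans le); rewrite leq_add2r.
Qed.

(** A reducible [C] is the product of two subgroups with a smaller sum of
displacements under the generators: equal displacements would force [C] to be
expanded or contracted as a whole. *)
Lemma irreducible_generate_aux C S : tidy_limit C ->
  (forall y, y \in Y -> C `<=` par y) ->
  (forall x y, S x -> S y -> S (x * y)) ->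
  (forall D, irreducible D -> D `<=` C -> D `<=` S) -> C `<=` S.
Proof.
have [n] := ubnP (\sum_(y <- Y) disp y C)%N.
elim: n C => // n IH C; rewrite ltnS => leC lC Cp SM irrS.
have [[b [Bb Cb Cb']]|irr] := pselect
    (exists b, [/\ B b, ~ C `<=` par b & ~ C `<=` par b^-1]); last first.
  apply: irrS => //; split=> // b Bb; apply: contrapT => /not_orP[? ?].
  by apply: irr; exists b.
have part c : B c -> ~ C `<=` par c -> plus c C `<=` S.
  move=> Bc nC; have lp := tidy_limit_plus Bc lC; have pC := @plus_sub _ c C.
  apply: IH => //.
  - apply: leq_trans leC; apply: sum_disp_lt => // le; apply: nC.
    apply: (par_of_equal_disp lp lC) => //.
    by apply: plus_par; exact: tidy_limit_compact.
  - by move=> y yY z /pC; exact: Cp.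
  - by move=> D irrD DC; apply: irrS => // z /DC/pC.
move=> x Cx; have [y Cy Cyx] := tidy_limit_factor Bb lC Cx.
rewrite -[x](mulVKg y); apply: SM; first exact: part Cy.
by apply: (part b^-1) => //; exact: BV.
Qed.

End Strictness.

Variable X : seq (topAut G).
Hypothesis XB : forall y, y \in X -> B y.
Hypothesis Xgen : forall K : set G, (forall y, y \in X -> y @` K = K) ->
  forall h, H h -> h @` K = K.

(** Factoring with respect to each generator in turn reduces to the case where every
generator, or its inverse, expands the group. *)
Lemma irreducible_generate C S : tidy_limit C ->
  (forall x y, S x -> S y -> S (x * y)) ->
  (forall D, irreducible D -> D `<=` C -> D `<=` S) -> C `<=` S.
Proof.
move=> lC SM irrS.
have orth (l : seq (topAut G)) D : {subset l <= X} -> tidy_limit D ->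
    (forall E, tidy_limit E -> E `<=` D ->
      (forall x, x \in l -> E `<=` par x \/ E `<=` par x^-1) -> E `<=` S) ->
    D `<=` S.
  elim: l D => [|x l IH] D lX lD ES; first by apply: ES.
  apply: (IH D) => //; first by move=> y yl; apply: lX; rewrite inE yl orbT.
  move=> E lE ED El.
  have Bx : B x by apply: XB; apply: lX; exact: mem_head.
  have part c : B c -> c = x \/ c = x^-1 -> plus c E `<=` S.
    move=> Bc cx; apply: ES; first exact: tidy_limit_plus.
      by move=> z /plus_sub/ED.
    have kE := tidy_limit_compact lE.
    move=> y; rewrite inE => /predU1P[->|/El[]Ey].
    - by case: cx => <-; [left|right]; exact: plus_par.
    - by left=> z /plus_sub/Ey.
    - by right=> z /plus_sub/Ey.
  move=> z Ez; have [y Ey Eyz] := tidy_limit_factor Bx lE Ez.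
  rewrite -[z](mulVKg y); apply: SM; first by apply: part Ey => //; left.
  by apply: part Eyz; [exact: BV|right].
apply: (orth X) => // D lD DC Dx.
pose s x := if `[< D `<=` par x >] then x else x^-1.
have sB y : y \in map s X -> B y.
  move=> /mapP[x xX ->]; rewrite /s; case: ifP => _; first exact: XB.
  by apply: BV; exact: XB.
apply: (irreducible_generate_aux (Y := map s X)) => //.
- move=> K Ks h Hh; apply: Xgen => // x xX.
  have := Ks (s x) (map_f s xX); rewrite /s; case: ifP => _ // e.
  by rewrite -{1}e img_autVK.
- move=> y /mapP[x xX ->]; rewrite /s; case: asboolP => // nD.
  by have [] := Dx x xX.
- by move=> E irrE ED; apply: irrS => // z /ED/DC.
Qed.

Lemma irreducible_cmp b D : B b -> irreducible D -> D `<=` b @` D \/ b @` D `<=` D.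
Proof.
move=> Bb [lD /(_ b Bb)[Dp|Dp]]; [left|right]; first exact: tidy_limit_sub_img.
have /(img_autS (a := b)) := tidy_limit_sub_img (BV Bb) lD Dp.
by rewrite img_autVK.
Qed.

End TidyIntersections.

(** * Homomorphisms to the positive rationals *)

Section Generated.
Variable Q : groupType.
Implicit Types (F H K : set Q) (x y h t u : Q).

Lemma generated_ind F K : subgroup K -> F `<=` K -> generated F `<=` K.
Proof. by move=> sK FK; apply: smallest_sub. Qed.

Lemma generated_incl F : F `<=` generated F.
Proof. exact: sub_gen_smallest. Qed.

Lemma generated_cycle t u : generated [set t] u ->
  exists k, u = t ^+ k \/ u = t ^- k.
Proof.
apply: (generated_ind (K := [set u | exists k, u = t ^+ k \/ u = t ^- k])); last first.
  by move=> _ ->; exists 1%N; left.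
have sub a b : exists k, t ^+ a * t ^- b = t ^+ k \/ t ^+ a * t ^- b = t ^- k.
  have [ba|ab] := leqP b a; first by exists (a - b)%N; left; rewrite expgnFr.
  exists (b - a)%N; right; rewrite expgnFr ?(ltnW ab)//.
  by rewrite invgM invgK.
have com a b : t ^- a * t ^+ b = t ^+ b * t ^- a.
  by apply: (mulgI (t ^+ a)); rewrite mulVKg mulgA -expgnDr addnC expgnDr mulgK.
apply/subgroupP; split; first by exists 0%N; left.
move=> x y [a ax] [b bx]; case: ax bx => -> [] ->.
- exact: sub.
- by exists (a + b)%N; left; rewrite invgK expgnDr.
- by exists (b + a)%N; right; rewrite expgnDr invgM.
- by rewrite invgK com; exact: sub.
Qed.

End Generated.

Section RationalHom.
Variable Q : groupType.
Implicit Types (F H K : set Q) (x y h t u : Q) (f : Q -> rat).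

Definition rat_hom H f := (forall h, H h -> 0 < f h)%R /\
  (forall g h, H g -> H h -> f (g * h) = (f g * f h)%R).

(** The shape of the modulus of a group that is either expanded or contracted. *)
Definition int_or_inv_le N (r : rat) := exists n : nat,
  [/\ (0 < n)%N, (n <= N)%N & r = (n%:R)%R \/ r = (n%:R^-1)%R].

Definition int_or_inv r := exists N, int_or_inv_le N r.

Lemma rat_hom1 H f : subgroup H -> rat_hom H f -> f 1 = 1%R.
Proof.
move=> sH [fP fM]; have H1 := sg1 sH.
have : (f 1%g * f 1%g = f 1%g * 1)%R by rewrite -fM// mulg1 mulr1.
by apply: mulfI; rewrite gt_eqF// fP.
Qed.

Lemma rat_homV H f h : subgroup H -> rat_hom H f -> H h -> f h^-1 = ((f h)^-1)%R.
Proof.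
move=> sH fH Hh; have [fP fM] := fH.
have fh0 : f h != 0%R by rewrite gt_eqF// fP.
apply: (mulfI fh0); rewrite -fM//; last exact: sgV.
by rewrite mulgV (rat_hom1 sH fH) mulfV.
Qed.

Lemma rat_hom_ext F H f f' : H = generated F -> rat_hom H f -> rat_hom H f' ->
  (forall x, F x -> f x = f' x) -> forall h, H h -> f h = f' h.
Proof.
move=> HE fH f'H ff'; have sH : subgroup H by rewrite HE; exact: generated_subgroup.
suff HK : H `<=` [set h | H h /\ f h = f' h] by move=> h /HK[].
rewrite {1}HE; apply: generated_ind => [|x Fx]; last first.
  by split; [rewrite HE; exact: generated_incl|exact: ff'].
apply/subgroupP; split.
  by split; [exact: sg1|rewrite (rat_hom1 sH fH) (rat_hom1 sH f'H)].
move=> x y [Hx ex] [Hy ey]; have Hy' := sgV sH Hy; split; first exact: sgM.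
by rewrite fH.2// f'H.2// (rat_homV sH fH)// (rat_homV sH f'H)// ex ey.
Qed.

(** A multiplicative group of rationals consisting of integers and their inverses
is generated by its least integer [n > 1]: dividing a larger integer [m] of the
group by [n] leaves a smaller one. *)
Lemma rat_hom_cyclic H f : subgroup H -> rat_hom H f ->
  (forall h, H h -> int_or_inv (f h)) ->
  exists t, [/\ H t, (1 <= f t)%R &
    forall h, H h -> exists2 u, generated [set t] u & f u = f h].
Proof.
move=> sH fH fI; have [fP fM] := fH; have f1 := rat_hom1 sH fH; have H1 := sg1 sH.
have [triv|/existsNP[h0 /not_implyP[Hh0 fh0]]] := pselect (forall h, H h -> f h = 1%R).
  exists 1; split=> //; first by rewrite f1.
  by move=> h /triv ->; exists 1; [apply: sg1; exact: generated_subgroup|].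
pose P n := `[< exists2 h, H h & (1 < n)%N /\ f h = (n%:R)%R >].
have int_ge1 h : H h -> (1 <= f h)%R -> exists2 n, (0 < n)%N & f h = (n%:R)%R.
  move=> Hh fh1; have [N [n [n0 _ [e|e]]]] := fI h Hh; exists n => //.
  move: fh1; rewrite e invf_ge1 ?ltr0n// lern1 => n1.
  by have -> : n = 1%N by apply/eqP; rewrite eqn_leq n1.
have exP : exists n, P n.
  have big h : H h -> (1 < f h)%R -> exists n, P n.
    move=> Hh fh1; have [n _ e] := int_ge1 h Hh (ltW fh1).
    by exists n; apply/asboolP; exists h => //; rewrite -(ltr1n rat) -e.
  have [lt1|gt1|e] := ltgtP (f h0) 1%R; last by [].
    apply: (big h0^-1); first exact: sgV.
    by rewrite (rat_homV sH fH)// invf_gt1 ?fP.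
  exact: (big h0).
case: (ex_minnP exP) => n /asboolP[t Ht [n1 ft]] nmin.
have tH : generated [set t] `<=` H by apply: generated_ind => // _ ->.
have st : subgroup (generated [set t]) := generated_subgroup _.
have n0 : (n%:R != 0 :> rat)%R by rewrite pnatr_eq0 -lt0n ltnW.
have main m h : H h -> f h = (m%:R)%R -> (0 < m)%N -> exists2 u, generated [set t] u & f u = f h.
  have [k] := ubnP m; elim: k m h => // k IH m h; rewrite ltnS => mk Hh fh m0.
  have [m1|m1] := leqP m 1.
    exists 1; first exact: sg1.
    by rewrite f1 fh; have -> : m = 1%N by apply/eqP; rewrite eqn_leq m1.
  have nm : (n <= m)%N by apply: nmin; apply/asboolP; exists h.
  have Hht : H (h * t^-1) by apply: sgM => //; exact: sgV.
  have fht : f (h * t^-1) = (m%:R / n%:R)%R.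
    by rewrite fM//; [rewrite (rat_homV sH fH)// fh ft|exact: sgV].
  have [|m' m'0 fm'] := int_ge1 _ Hht.
    by rewrite fht ler_pdivlMr ?mul1r ?ler_nat// ltr0n ltnW.
  have em : m = (m' * n)%N.
    apply/eqP; rewrite -(eqr_nat rat) natrM -fm' fht.
    by rewrite divfK.
  have [|u tu fu] := IH m' (h * t^-1) _ Hht fm' m'0.
    by apply: leq_trans mk; rewrite em -{1}[m']muln1 ltn_pmul2l.
  exists (u * t); first by apply: (sgM st) => //; exact: generated_incl.
  by rewrite fM ?fu; [rewrite -fM ?mulgVK|exact: tH|].
exists t; split=> //; first by rewrite ft ler1n ltnW.
move=> h Hh; have [h1|h1] := leP 1%R (f h).
  by have [m m0 fm] := int_ge1 h Hh h1; exact: main fm m0.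
have [||m m0 fm] := int_ge1 h^-1; first exact: sgV.
  by rewrite (rat_homV sH fH)// invf_ge1 ?fP// ltW.
have [|u tu fu] := main _ _ _ fm m0; first exact: sgV.
exists u^-1; first exact: (sgV st).
rewrite (rat_homV sH fH) ?fu; last exact: tH.
by rewrite (rat_homV sH fH)// invrK.
Qed.

Variables (X : seq Q) (N : nat).
Notation H := (generated [set` X]).

Definition bounded_hom f := rat_hom H f /\ forall x, x \in X -> int_or_inv_le N (f x).

(** A homomorphism is determined by its values on the generators, which here range
over a finite set. *)
Lemma finite_bounded_homs : exists (W : finType) (F : W -> Q -> rat),
  forall f, bounded_hom f -> exists2 w, bounded_hom (F w) & forall h, H h -> F w h = f h.
Proof.
pose v (p : 'I_N.+1 * bool) : rat := if p.2 then (p.1%:R)%R else (p.1%:R^-1)%R.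
pose W := {ffun 'I_(size X) -> 'I_N.+1 * bool}.
pose P (w : W) := [set f | bounded_hom f /\ forall i : 'I_(size X), f (nth 1 X i) = v (w i)].
exists W, (fun w => xget (fun=> 1%R) (P w)) => f bf.
have /choice[w wP] (i : 'I_(size X)) : exists p, f (nth 1 X i) = v p.
  have [n [n0 nN [e|e]]] := bf.2 (nth 1 X i) (mem_nth _ (ltn_ord i)).
    by exists (inord n, true); rewrite e /v/= inordK.
  by exists (inord n, false); rewrite e /v/= inordK.
have Pf : P [ffun i => w i] f by split=> // i; rewrite ffunE.
exists [ffun i => w i]; case: xgetP => [g _ [] //|/(_ f)//].
move=> [gH gb] gw; apply: (rat_hom_ext _ gH bf.1) => // x /= /nthP-/(_ 1)[i iX <-].
by have := gw (Ordinal iX); rewrite ffunE /= => ->; rewrite -wP.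
Qed.

(** For each of the finitely many bounded homomorphisms [f], either one element with
[f] neither an integer nor an inverse of one excludes [f], or the image is cyclic;
then take a generator [t] of the image and, for each [x] in [X], an element
[x u^-1] of the kernel of [f] with [u] a power of [t]. *)
Lemma cyclic_test_set : exists S : seq Q, (forall s, s \in S -> H s) /\
  forall f, bounded_hom f -> (forall s, s \in S -> int_or_inv (f s)) ->
  exists t, [/\ t \in S, (1 <= f t)%R & forall x, x \in X ->
    exists u, [/\ generated [set t] u, f u = f x & x * u^-1 \in S]].
Proof.
have sH : subgroup H := generated_subgroup _.
have XH x : x \in X -> H x by exact: generated_incl.
have [W [F FP]] := finite_bounded_homs.
have /choice[S SP] w : exists S : seq Q, (forall s, s \in S -> H s) /\
    (bounded_hom (F w) -> (forall s, s \in S -> int_or_inv (F w s)) ->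
    exists t, [/\ t \in S, (1 <= F w t)%R & forall x, x \in X ->
      exists u, [/\ generated [set t] u, F w u = F w x & x * u^-1 \in S]]).
  have [bF|nbF] := pselect (bounded_hom (F w)); last by exists [::].
  have [int|/existsNP[h /not_implyP[Hh nint]]] :=
    pselect (forall h, H h -> int_or_inv (F w h)); last first.
    exists [:: h]; split; first by move=> s; rewrite inE => /eqP ->.
    by move=> _ /(_ h (mem_head _ _)).
  have [t [Ht ft tP]] := rat_hom_cyclic sH bF.1 int.
  have /choice[u uP] (x : Q) : exists u, x \in X -> generated [set t] u /\ F w u = F w x.
    have [xX|//] := boolP (x \in X); last by exists 1.
    by have [u tu fu] := tP x (XH x xX); exists u.
  have tH : generated [set t] `<=` H by apply: generated_ind => // _ ->.
  exists (t :: [seq x * (u x)^-1 | x <- X]); split.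
    move=> s; rewrite inE => /predU1P[->//|/mapP[x xX ->]].
    by apply: (sgM sH); [exact: XH|apply: (sgV sH); apply: tH; have [] := uP x xX].
  move=> _ _; exists t; split=> //; first exact: mem_head.
  move=> x xX; have [tu fu] := uP x xX; exists (u x); split=> //.
  by rewrite inE (map_f (fun x => x * (u x)^-1))// orbT.
exists (flatten [seq S w | w <- enum W]).
have memS w s : s \in S w -> s \in flatten [seq S w | w <- enum W].
  by move=> sS; apply/flatten_mapP; exists w => //; rewrite mem_enum.
split; first by move=> s /flatten_mapP[w _]; exact: (SP w).1.
move=> f /FP[w bF Ff] fS.
have tH t : H t -> generated [set t] `<=` H by move=> Ht; apply: generated_ind => // _ ->.
have [|t [tS ft tP]] := (SP w).2 bF.
  by move=> s sS; rewrite Ff; [exact/fS/(memS w)|exact: (SP w).1].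
have Ht := (SP w).1 t tS.
exists t; split; [exact: memS tS|by rewrite -Ff|].
move=> x xX; have [u [tu fu xu]] := tP x xX; exists u; split=> //; last exact: memS xu.
by rewrite -!Ff//; [exact: XH|exact: (tH t)].
Qed.

(** Finitely many homomorphisms to the positive rationals produce finitely many
patterns of comparisons with [1]. *)
Lemma sign_test_set : exists S : seq Q, (forall s, s \in S -> H s) /\
  forall g, H g -> exists2 s, s \in S & forall f, bounded_hom f ->
    (1 <= f s)%R = (1 <= f g)%R /\ (f s <= 1)%R = (f g <= 1)%R.
Proof.
have [W [F FP]] := finite_bounded_homs.
pose sg g : {ffun W -> bool * bool} := [ffun w => (1 <= F w g, F w g <= 1)%R].
pose rep p := xget 1 [set g | H g /\ sg g = p].
have sH : subgroup H := generated_subgroup _.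
exists [seq rep p | p <- enum {ffun W -> bool * bool}]; split.
  move=> s /mapP[p _ ->]; rewrite /rep; case: xgetP => [g _ []//|_]; exact: sg1.
move=> g Hg; exists (rep (sg g)); first by apply: map_f; rewrite mem_enum.
move=> f /FP[w _ Ff].
have : H (rep (sg g)) /\ sg (rep (sg g)) = sg g.
  by rewrite /rep; case: xgetP => [? _ //|/(_ g)/(_ (conj Hg erefl))].
move=> [Hr /(congr1 (fun p : {ffun W -> bool * bool} => p w))]; rewrite !ffunE => -[e1 e2].
by rewrite -!Ff.
Qed.

End RationalHom.

(** * Moduli of irreducible subgroups *)

Section RelativeIndex.
Variable Q : groupType.
Implicit Types A B C : set Q.

Definition rind A B : rat := ((ind A B)%:R / (ind B A)%:R)%R.

Lemma rind_trans A B C : subgroup A -> subgroup B -> subgroup C ->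
  fin A B -> fin B A -> fin B C -> fin C B ->
  rind A C = (rind A B * rind B C)%R.
Proof.
move=> sA sB sC AB BA BC CB.
pose I := A `&` B `&` C.
have sAB := sgI sA sB; have sI : subgroup I by exact: sgI.
have AC := fin_trans AB BC; have CA := fin_trans CB BA.
have fA : fin A I.
  apply: fin_trans (fin_interr sA sB AB) _; apply: fin_interr => //.
  exact: fin_sub AC.
have g D E : subgroup D -> subgroup E -> fin D E -> ((ind D E)%:R != 0 :> rat)%R.
  by move=> sD sE DE; rewrite pnatr_eq0 -lt0n ind_gt0.
have key D E : subgroup D -> subgroup E -> I `<=` D `&` E -> fin D E -> fin E D ->
    fin D I -> fin E I -> rind D E = ((ind D I)%:R / (ind E I)%:R)%R.
  move=> sD sE IDE DE ED DI EI; apply/eqP; rewrite /rind eqr_div ?g//.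
  rewrite -!natrM eqr_nat; apply/eqP; rewrite (mulnC (ind D I)).
  by apply: ind_cross => //; apply: fin_sub DI => x [].
have fB : fin B I by exact: fin_trans BA fA.
have fC : fin C I by exact: fin_trans CA fA.
rewrite !key//.
- by rewrite mulrA divfK ?g.
- by move=> x [[]].
- by move=> x [[]].
- by move=> x [[]].
Qed.

End RelativeIndex.

Section Modulus.
Variable G : topologicalGroupType.
Implicit Types (b g h : topAut G) (D U : set G).

Variables (X : seq (topAut G)) (B : set (topAut G)).
Notation H := (generated [set` X]).
Hypothesis BH : B `<=` H.
Hypothesis BV : forall b, B b -> B b^-1.
Hypothesis BJ : forall h b, H h -> B b -> B (h * b * h^-1).
Hypothesis XB : forall x, x \in X -> B x.

Let sH : subgroup H := generated_subgroup _.

Lemma fixed_by_generators D : (forall x, x \in X -> x @` D = D) ->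
  forall h, H h -> h @` D = D.
Proof.
move=> XD; suff : H `<=` [set h | h @` D = D] by [].
apply: generated_ind => // ; apply/subgroupP; split; first exact: img_aut1.
by move=> g h gD hD; rewrite /mkset img_autM -{1}hD img_autK.
Qed.

(** Each generator has finite displacement on [D], and commensurability is
transitive. *)
Lemma tidy_limit_commensurable D h : tidy_limit B D -> H h -> fin (h @` D) D /\ fin D (h @` D).
Proof.
move=> lD; have sD := tidy_limit_sg lD; move: h.
suff : H `<=` [set h | fin (h @` D) D /\ fin D (h @` D)] by [].
have inv g : fin (g @` D) D -> fin D ((g^-1)%g @` D).
  by move=> f; rewrite -[X in fin X](img_autK g); exact: fin_aut.
apply: generated_ind => [|x /XB Bx]; last first.
  split; first exact: (tidy_limit_fin sH BH BJ).
  by rewrite -[x]invgK; apply: inv; apply: (tidy_limit_fin sH BH BJ) => //; exact: BV.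
have inv' g : fin D (g @` D) -> fin ((g^-1)%g @` D) D.
  move=> f; rewrite -{2}(img_autK g D); apply: fin_aut => //.
  exact: aut_sg.
apply/subgroupP; split; first by split; rewrite img_aut1; exact: fin_subset.
move=> g h [g1 g2] [h1 h2]; rewrite /mkset img_autM; split.
  by apply: fin_trans g1; apply: fin_aut => //; exact: inv'.
apply: fin_trans g2 _; apply: fin_aut; last exact: inv.
exact: aut_sg.
Qed.

(** The factor by which [h] scales a Haar measure of [D]. *)
Definition modulus D h : rat := rind (h @` D) D.

(** By invariance of relative indices under automorphisms, [h @` D] and [D] have the
same relative index as their images by [g]. *)
Lemma modulus_hom D : tidy_limit B D -> rat_hom H (modulus D).
Proof.
move=> lD; have sD := tidy_limit_sg lD; split=> [h Hh|g h Hg Hh].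
  have [f1 f2] := tidy_limit_commensurable lD Hh; have shD := aut_sg h sD.
  by rewrite divr_gt0// ltr0n ind_gt0.
have [g1 g2] := tidy_limit_commensurable lD Hg; have [h1 h2] := tidy_limit_commensurable lD Hh.
have sgD := aut_sg g sD; have shD := aut_sg h sD.
rewrite /modulus img_autM (@rind_trans _ _ (g @` D)) //; first last.
- exact: fin_aut.
- exact: fin_aut.
- exact: aut_sg.
by rewrite mulrC /rind !ind_aut.
Qed.

Lemma modulus_expand D h : tidy_limit B D -> H h -> D `<=` h @` D ->
  modulus D h = ((disp h D)%:R)%R.
Proof.
move=> lD Hh Dh; have sD := tidy_limit_sg lD; have shD := aut_sg h sD.
by rewrite /modulus /rind (ind_subset sD shD Dh) divr1.
Qed.

Lemma modulus_contract D h : tidy_limit B D -> H h -> h @` D `<=` D ->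
  modulus D h = ((disp (h^-1)%g D)%:R^-1)%R.
Proof.
move=> lD Hh Dh; have sD := tidy_limit_sg lD; have shD := aut_sg h sD.
have [_ f] := tidy_limit_commensurable lD Hh.
rewrite /modulus /rind (ind_subset shD sD Dh) div1r /disp.
by rewrite -(ind_aut h^-1 shD f) img_autK.
Qed.

Lemma disp_gt0_limit D h : tidy_limit B D -> H h -> (0 < disp h D)%N.
Proof.
move=> lD Hh; have sD := tidy_limit_sg lD; have shD := aut_sg h sD.
by apply: ind_gt0 => //; have [] := tidy_limit_commensurable lD Hh.
Qed.

Lemma modulus_expand_ge1 D h : tidy_limit B D -> H h -> D `<=` h @` D -> (1 <= modulus D h)%R.
Proof. by move=> lD Hh Dh; rewrite modulus_expand// ler1n disp_gt0_limit. Qed.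

Lemma modulus_contract_le1 D h : tidy_limit B D -> H h -> h @` D `<=` D -> (modulus D h <= 1)%R.
Proof.
move=> lD Hh Dh; have Hh' := sgV sH Hh.
by rewrite modulus_contract// invf_le1 ?ler1n ?ltr0n disp_gt0_limit.
Qed.

Definition comparable D h := D `<=` h @` D \/ h @` D `<=` D.

Lemma expand_of_modulus D h : tidy_limit B D -> H h -> comparable D h ->
  (1 <= modulus D h)%R -> D `<=` h @` D.
Proof.
move=> lD Hh [//|Dh]; have Hh' := sgV sH Hh; have sD := tidy_limit_sg lD.
rewrite modulus_contract// invf_ge1 ?ltr0n ?disp_gt0_limit// lern1 => le1.
have [f _] := tidy_limit_commensurable lD Hh'.
have /(img_autS (a := h)) := ind_le1 (aut_sg h^-1 sD) sD f le1.
by rewrite img_autVK.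
Qed.

Lemma contract_of_modulus D h : tidy_limit B D -> H h -> comparable D h ->
  (modulus D h <= 1)%R -> h @` D `<=` D.
Proof.
move=> lD Hh [Dh|//]; have sD := tidy_limit_sg lD.
rewrite modulus_expand// lern1 => le1.
have [f _] := tidy_limit_commensurable lD Hh.
exact: ind_le1 (aut_sg h sD) sD f le1.
Qed.

Lemma modulus_int_or_inv D b N : irreducible B D -> B b ->
  (disp b D <= N)%N -> (disp b^-1 D <= N)%N -> int_or_inv_le N (modulus D b).
Proof.
move=> irrD Bb dN dN'; have lD := irrD.1; have Hb := BH Bb; have Hb' := sgV sH Hb.
have [Db|bD] := irreducible_cmp BV Bb irrD.
  by exists (disp b D); rewrite disp_gt0_limit// modulus_expand//; split=> //; left.
by exists (disp b^-1 D); rewrite disp_gt0_limit// modulus_contract//; split=> //; right.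
Qed.

(** The element [t] expands, and each [x u^-1] fixes, all the translates of [D]:
their conjugates are in [B], and comparability together with the modulus decides.
So every element of [H] acts on the translates of [D] as some power of [t], and
these powers form a chain. *)
Lemma irreducible_comparable D (S : seq (topAut G)) t :
  irreducible B D -> (forall s, s \in S -> B s) -> t \in S ->
  (1 <= modulus D t)%R ->
  (forall x, x \in X -> exists u,
    [/\ generated [set t] u, modulus D u = modulus D x & x * u^-1 \in S]) ->
  forall h, H h -> comparable D h.
Proof.
move=> irrD SB tS t1 tX; have lD := irrD.1; have sD := tidy_limit_sg lD.
have [mP mM] := modulus_hom lD.
have Ht : H t by apply: BH; exact: SB.
have tH : generated [set t] `<=` H by apply: generated_ind => // _ ->.
have conjE g b : H g -> H b -> modulus D (g^-1 * b * g) = modulus D b.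
  move=> Hg Hb; have Hg' := sgV sH Hg.
  rewrite mM//; last exact: (sgM sH).
  by rewrite mM// mulrAC -mM// mulVg (rat_hom1 sH (modulus_hom lD)) mul1r.
have cmpJ g b : H g -> B b -> comparable D (g^-1 * b * g).
  move=> Hg Bb; apply: (irreducible_cmp BV) => //.
  by rewrite -{2}[g]invgK; apply: BJ => //; exact: (sgV sH).
have img_conj g b : g @` ((g^-1 * b * g) @` D) = b @` (g @` D).
  by rewrite -!img_autM !mulgA mulgV mul1g.
have HJ g b : H g -> H b -> H (g^-1 * b * g).
  by move=> Hg Hb; apply: (sgM sH) => //; exact: (sgVM sH).
have texp g : H g -> g @` D `<=` t @` (g @` D).
  move=> Hg; rewrite -img_conj; apply: img_autS.
  apply: expand_of_modulus => //; [exact: HJ|apply: cmpJ => //; exact: SB|].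
  by rewrite conjE.
have tX' x : x \in X -> exists2 u, generated [set t] u &
    forall g, H g -> x @` (g @` D) = u @` (g @` D).
  move=> xX; have [u [tu mu sS]] := tX x xX; exists u => // g Hg.
  have Hu := tH u tu; have Hx : H x by exact: generated_incl.
  have Hug : H (u * g) by exact: (sgM sH).
  have Bs := SB _ sS; pose c := (u * g)^-1 * (x * u^-1) * (u * g).
  have Hc : H c by apply: HJ => //; exact: BH.
  have mc : modulus D c = 1%R.
    rewrite conjE//; last exact: BH.
    rewrite mM//; last exact: (sgV sH).
    by rewrite (rat_homV sH (modulus_hom lD))// mu mulfV// gt_eqF// mP.
  have cD : c @` D = D.
    have cmpc : comparable D c by exact: cmpJ.
    rewrite eqEsubset; split.
      by apply: contract_of_modulus => //; rewrite mc.
    by apply: expand_of_modulus => //; rewrite mc.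
  have := img_conj (u * g) (x * u^-1).
  rewrite -/c cD -!img_autM => ->.
  by rewrite !gE.
have sT : subgroup (generated [set t]) := generated_subgroup _.
pose E := [set h | H h /\ exists2 u, generated [set t] u &
  forall g, H g -> h @` (g @` D) = u @` (g @` D)].
have HE : H `<=` E.
  rewrite {1}/generated; apply: smallest_sub => [|x xX]; last first.
    by split; [exact: generated_incl|exact: tX'].
  apply/subgroupP; split.
    by split; [exact: (sg1 sH)|exists 1; [exact: sg1|]].
  move=> x y [Hx [u tu ux]] [Hy [v tv vy]].
  have Hy' := sgV sH Hy; split; first exact: (sgM sH).
  have tv' := sgV sT tv.
  exists (u * v^-1); first exact: (sgM sT).
  move=> g Hg; have Hvg : H (v^-1 * g) by apply: (sgM sH) => //; exact: tH.
  have yv : (y^-1)%g @` (g @` D) = (v^-1)%g @` (g @` D).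
    rewrite -[RHS](img_autK y); congr (_ @` _).
    by rewrite -(img_autM v^-1 g) vy// -img_autM mulVKg.
  by rewrite !img_autM yv -(img_autM v^-1 g) ux.
move=> h /HE[_ [u /generated_cycle[k uk] hu]].
have -> : comparable D h = comparable D u.
  by rewrite /comparable; have := hu 1 (sg1 sH); rewrite !img_aut1 => ->.
have tk : D `<=` (t ^+ k) @` D.
  have Htk n : H (t ^+ n).
    by elim: n => [|n IH]; [exact: (sg1 sH)|rewrite expgS; exact: (sgM sH)].
  elim: k {uk} => [|k IH]; first by rewrite img_aut1.
  by apply: (subset_trans IH); rewrite expgS img_autM; exact: texp.
case: uk => ->; [by left|right].
by move=> _ [x /tk + <-]; rewrite img_autE.
Qed.

End Modulus.

(** * Finitely generated groups with local tidy subgroups *)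

Theorem theorem5p5 (G : topologicalGroupType) (H : set (topAut G)) :
  totally_disconnected [set: G] ->
  locally_compact [set: G] ->
  subgroup H ->
  finitely_generated H ->
  has_local_tidy_subgroups H ->
  exists U : set G, compact_open_subgroup U /\ tidy_for H U.
Proof.
move=> _ _ _ [F0 /finite_seqP[X ->] HE] ltH.
have sH : subgroup H by rewrite HE; exact: generated_subgroup.
have XH x : x \in X -> H x by move=> xX; rewrite HE; exact: generated_incl.
have [V [cV tV]] := ltH _ (finite_seq X) XH.
have tidyV x : x \in X -> tidy x V.
  by move=> xX; rewrite -[V]img_aut1; apply: tV => //; apply: sg1; exact: generated_subgroup.
(* a bound that also applies to [U], chosen later: tidy subgroups have the same
   displacement *)
pose N := (\max_(x <- X) maxn (disp x V) (disp x^-1 V))%N.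
have [S [SH SP]] := cyclic_test_set X N; have [S' [SH' SP']] := sign_test_set X N.
rewrite -HE in SH SH' SP'.
pose test := X ++ S ++ S'.
have bH x : x \in test -> H x.
  by rewrite !mem_cat => /or3P[/XH|/SH|/SH'].
have [U [cU tU]] := ltH _ (finite_seq test) bH.
have Hb : generated [set` test] = H.
  rewrite eqEsubset; split; first exact: generated_ind.
  rewrite HE; apply: generated_ind; first exact: generated_subgroup.
  by move=> x /= xX; apply: generated_incl; rewrite /= mem_cat xX.
pose B := [set c | exists h a, [/\ H h, a \in test & c = h * a * h^-1 \/ c = h * a^-1 * h^-1]].
have BH : B `<=` H.
  move=> _ [h [a [Hh /bH Ha [->|->]]]]; apply: (sgM sH); try exact: (sgV sH);
    apply: (sgM sH) => //; exact: (sgV sH).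
have BV c : B c -> B c^-1.
  move=> [h [a [Hh ab ch]]]; exists h, a; split=> //.
  by case: ch => ->; [right|left]; rewrite !invgM !invgK mulgA.
have BJ h c : H h -> B c -> B (h * c * h^-1).
  move=> Hh [g [a [Hg ab cg]]]; exists (h * g), a; split=> //; first exact: (sgM sH).
  by case: cg => ->; [left|right]; rewrite invgM !mulgA.
have bB c : c \in test -> B c.
  move=> cb; exists 1, c; split=> //; first exact: (sg1 sH).
  by left; rewrite !gE.
have fU : common_tidy B U.
  split=> // c [h [a [Hh ab ch]]].
  have tJ : tidy (h * a * h^-1) U.
    rewrite -{1}[h]invgK; apply/tidy_conj; apply: tU => //.
    by rewrite Hb; exact: (sgV sH).
  case: ch => ->; first exact: tJ.
  have -> : h * a^-1 * h^-1 = (h * a * h^-1)^-1 by rewrite !gE.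
  exact: tidy_inv.
have XB x : x \in X -> B x by move=> xX; apply: bB; rewrite mem_cat xX.
have lU := common_tidy_limit fU.
have sH' : subgroup (generated [set` X]) by exact: generated_subgroup.
have bounded D : irreducible B D -> D `<=` U -> bounded_hom X N (modulus D).
  move=> irrD DU; have lD := irrD.1; split.
    by apply: (modulus_hom (B := B)) => //; rewrite -HE.
  move=> x xX; have Bx := XB x xX; have Bx' := BV _ Bx.
  have dN c : B c -> tidy c V -> (disp c V <= N)%N -> (disp c D <= N)%N.
    move=> Bc tc; apply: leq_trans; apply: (@leq_trans (disp c U)).
      exact: (tidy_limit_disp_le sH BH BJ).
    by have [_ tcU] := fU; have /tidyP[_] := tcU c Bc; apply.
  have xN : (maxn (disp x V) (disp x^-1 V) <= N)%N.
    exact: (leq_bigmax_seq (F := fun x => maxn (disp x V) (disp x^-1 V))).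
  have /andP[xN1 xN2] : (disp x V <= N)%N && (disp (x^-1)%g V <= N)%N by rewrite -geq_max.
  apply: (modulus_int_or_inv (X := X) (B := B)) => //; rewrite -?HE//.
    by apply: dN => //; exact: tidyV.
  by apply: dN => //; apply: tidy_inv; exact: tidyV.
have comp D : irreducible B D -> D `<=` U -> forall h, H h -> comparable D h.
  move=> irrD DU h Hh; have bD := bounded D irrD DU.
  have [|t [tS t1 tP]] := SP _ bD.
    move=> s sS; have Bs : B s by apply: bB; rewrite !mem_cat sS orbT.
    exists (maxn (disp s D) (disp s^-1 D)).
    by apply: (modulus_int_or_inv (X := X) (B := B)); rewrite -?HE ?leq_maxl ?leq_maxr.
  have SB s : s \in S -> B s by move=> sS; apply: bB; rewrite !mem_cat sS orbT.
  rewrite HE in BH BJ Hh.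
  exact: (irreducible_comparable BH BV BJ XB irrD SB tS t1 tP).
exists U; split=> // g Hg.
(* [c] is an element of the finite set that compares with [1] as [g] does *)
have [c cS' csign] := SP' g Hg.
have Bc : B c by apply: bB; rewrite !mem_cat cS' !orbT.
have Bc' := BV _ Bc; have Hc := BH _ Bc.
have lA := tidy_limit_plus sH BH BJ Bc lU; have lA' := tidy_limit_plus sH BH BJ Bc' lU.
have [sA sA'] := (tidy_limit_sg lA, tidy_limit_sg lA').
have kU : compact U by case: cU.
have AU : plus c U `<=` U by exact: plus_sub.
have AU' : plus c^-1 U `<=` U by exact: plus_sub.
have Xgen : forall K : set G, (forall y, y \in X -> y @` K = K) ->
    forall h, H h -> h @` K = K.
  by move=> K KX; rewrite HE; exact: fixed_by_generators.
have gen C S0 := @irreducible_generate _ H B sH BH BV BJ X XB Xgen C S0.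
have limitH D h : tidy_limit B D -> H h -> tidy_limit B (h @` D).
  by move=> lD Hh; exact: (tidy_limit_img sH BJ).
have expD D : irreducible B D -> D `<=` plus c U -> D `<=` c @` D.
  move=> irrD DA; apply: (tidy_limit_sub_img (B := B)) => //; first exact: irrD.1.
  by move=> x /DA; exact: plus_par.
apply: (tidy_of_factor cU sA sA' AU AU').
- exact: (tidy_limit_factor (B := B)).
- suff Ag : plus c U `<=` g @` plus c U by move=> x /Ag; rewrite img_autE.
  apply: gen => // [x y|D irrD DA]; first by apply: sgM; exact: aut_sg.
  have lD := irrD.1; have DU := subset_trans DA AU.
  have m1 : (1 <= modulus D c)%R.
    by apply: (modulus_expand_ge1 (X := X) (B := B)); rewrite -?HE//; exact: expD.
  have gD : D `<=` g @` D.
    apply: (expand_of_modulus (X := X) (B := B)); rewrite -?HE//; first exact: comp.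
    by have [<- _] := csign _ (bounded D irrD DU).
  by apply: (subset_trans gD); exact: img_autS.
- suff Ag : plus c^-1 U `<=` (g^-1)%g @` plus c^-1 U.
    by move=> x /Ag; rewrite img_autE invgK.
  apply: gen => // [x y|D irrD DA]; first by apply: sgM; exact: aut_sg.
  have lD := irrD.1; have DU := subset_trans DA AU'.
  have cD : c @` D `<=` D.
    have Dc : D `<=` (c^-1)%g @` D.
      apply: (tidy_limit_sub_img (B := B)) => //.
      by move=> x /DA; exact: plus_par.
    by rewrite -[X in _ `<=` X](img_autVK c); exact: img_autS.
  have m1 : (modulus D c <= 1)%R.
    by apply: (modulus_contract_le1 (X := X) (B := B)); rewrite -?HE.
  have gD : g @` D `<=` D.
    apply: (contract_of_modulus (X := X) (B := B)); rewrite -?HE//; first exact: comp.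
    by have [_ <-] := csign _ (bounded D irrD DU).
  move=> x Dx; rewrite img_autE invgK; apply: DA; apply: gD; by exists x.
- move=> n x Ax Ux.
  (* the translates of an irreducible subgroup by powers of [g] are expanded by [c],
     because [modulus D] does not distinguish conjugate elements *)
  suff /(_ _ Ax) : plus c U `<=` [set y | par c ((g ^+ n) y)].
    by rewrite /mkset autXV => px; rewrite -tidy_par//; exact: fU.2.
  have Hgn : H (g ^+ n).
    by elim: n {x Ax Ux} => [|n IH]; [exact: (sg1 sH)|rewrite expgS; exact: (sgM sH)].
  apply: gen => // [y z|D irrD DA y Dy].
    by rewrite /mkset autM; apply: sgM; exact: sg_par.
  have lD := irrD.1; have DU := subset_trans DA AU.
  have Hgn' := sgV sH Hgn.
  have Hd : H ((g ^+ n)^-1 * c * g ^+ n) by apply: (sgM sH) => //; exact: (sgM sH).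
  have lgD := limitH D _ lD Hgn.
  have : (g ^+ n) @` D `<=` par c.
    apply: (tidy_limit_par_of_sub (B := B)) => //.
    have -> : c @` ((g ^+ n) @` D) = (g ^+ n) @` (((g ^+ n)^-1 * c * g ^+ n) @` D).
      by rewrite -!img_autM !mulgA mulgV mul1g.
    apply: img_autS; apply: (expand_of_modulus (X := X) (B := B)); rewrite -?HE//.
      exact: comp.
    have [mh _] := bounded D irrD DU; rewrite -HE in mh; have [mP mM] := mh.
    rewrite mM//; last exact: (sgM sH).
    rewrite mM// mulrAC -mM// mulVg (@rat_hom1 _ H)// mul1r.
    by apply: (modulus_expand_ge1 (X := X) (B := B)); rewrite -?HE//; exact: expD.
  by apply; exists y.
Qed.
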